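(* Let $1\le k\le n$ and let $\mathcal J=(J_1,\dots,J_n)$ be a Grassmann necklace of type $(k,n)$ whose positroid is connected, with positroid polytope $P_\mathcal J\subset\mathbb R^n$. Let $D_\mathcal J$ be the set of permutations $w=w_1\cdots w_n\in S_n$ with $w_n=n$ and exactly $k$ cyclic left descents such that $I_r(w)\ge_j J_j$ for all $r,j\in[n]$. Let $\Gamma_\mathcal J$ be the graph with vertex set $D_\mathcal J$ in which $u\neq w$ are adjacent if and only if the simplices $\Delta_{(u)}$ and $\Delta_{(w)}$ share a common facet. Fix any $w_0\in D_\mathcal J$ and let $(\mathcal P_{w_0,\mathcal J},\prec)$ be the partial order on $D_\mathcal J$ in which, for distinct $u,v$, $u\prec v$ if and only if some shortest path in $\Gamma_\mathcal J$ from $w_0$ to $v$ passes through $u$. For $w\in D_\mathcal J$ let $\mathrm{cover}(w)$ be the number of elements of $D_\mathcal J$ that $w$ covers in $\mathcal P_{w_0,\mathcal J}$. Then $$h^*(P_\mathcal J,z)=\sum_{w\in D_\mathcal J} z^{\mathrm{cover}(w)}.$$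
   Context: For $i\in[n]$, the $i$-order on $[n]$ is $i<_i i+1<_i\cdots<_i n<_i 1<_i\cdots<_i i-1$. For $k$-subsets $S=\{s_1<_i\cdots<_i s_k\}$ and $T=\{t_1<_i\cdots<_i t_k\}$ of $[n]$, $S\le_i T$ means $s_j\le_i t_j$ for all $j$. A Grassmann necklace of type $(k,n)$ is a sequence $(J_1,\dots,J_n)$ of $k$-subsets of $[n]$ such that for every $i$ (indices mod $n$): if $i\in J_i$ then $J_{i+1}=(J_i\setminus\{i\})\cup\{j\}$ for some $j\in[n]$, and if $i\notin J_i$ then $J_{i+1}=J_i$. Its positroid is the matroid on $[n]$ with bases $\mathcal B(\mathcal J)=\{B\in\binom{[n]}{k}: B\ge_i J_i\ \text{for all } i\in[n]\}$, and its positroid polytope is $P_\mathcal J=\mathrm{conv}\{e_B: B\in\mathcal B(\mathcal J)\}$ where $e_B=\sum_{i\in B}e_i$. The positroid is connected if this matroid is not a direct sum of two matroids on nonempty ground sets. Cyclic left descents: for $w\in S_n$ in one-line notation, $i<n$ is a cyclic left descent if $i$ occurs to the right of $i+1$ in $w$, and $n$ is a cyclic left descent if $1$ occurs to the left of $n$ in $w$; $\mathrm{cDes}_L(w)$ denotes the set of these. For $r\in[n]$, $w^{(r)}$ denotes the cyclic rotation of the word $w_1\cdots w_n$ that ends with $r$, and $I_r(w)=\mathrm{cDes}_L(w^{(r)})$. The $(w)$-simplex is $\Delta_{(w)}=\mathrm{conv}(e_{I_1(w)},\dots,e_{I_n(w)})$. (For connected positroids, the simplices $\Delta_{(w)}$,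 $w\in D_\mathcal J$, triangulate $P_\mathcal J$, which has dimension $n-1$.) For a lattice polytope $P$ of dimension $d$, the $h^*$-polynomial is defined by $\sum_{t\ge0}\#(tP\cap\mathbb Z^n)z^t=h^*(P,z)/(1-z)^{d+1}$. *)

(* Defs.v *)
From HB Require Import structures.
From mathcomp Require Import all_boot all_order all_algebra all_fingroup.
From mathcomp Require Import finmap.
From mathcomp Require Import boolp classical_sets cardinality reals.

Set Implicit Arguments.
Unset Strict Implicit.
Unset Printing Implicit Defensive.

Import Order.TTheory GRing.Theory Num.Theory.
Local Open Scope ring_scope.

(* The ground set [n] = {1, ..., n} is represented by 'I_n = {0, ..., n-1};
   the successor modulo n is ordS. *)

Section Combinatorics.
Variable n : nat.
Implicit Types (i j r : 'I_n) (S T B : {set 'I_n}) (w u v : {perm 'I_n}).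
Implicit Types (k : nat) (J : 'I_n -> {set 'I_n}).

(* All of [n] in the i-order: i, i+1, ..., n, 1, ..., i-1. *)
Definition cyc_enum i : seq 'I_n := rot i (enum 'I_n).

Definition cyc_le i (a b : 'I_n) : bool :=
  (index a (cyc_enum i) <= index b (cyc_enum i))%N.

(* s_1 <_i ... <_i s_k for S = {s_1, ..., s_k} *)
Definition cyc_sort i S : seq 'I_n := [seq x <- cyc_enum i | x \in S].

(* all2 is false on sequences of different sizes, so that sets of different
   cardinalities are incomparable. *)
Definition gale_le i S T : bool := all2 (cyc_le i) (cyc_sort i S) (cyc_sort i T).

Definition grassmann_necklace k J : Prop :=
  (forall i, #|J i| = k) /\
  (forall i, if i \in J i then exists j, J (ordS i) = j |: (J i :\ i)
             else J (ordS i) = J i).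

Definition positroid_bases k J : {set {set 'I_n}} :=
  [set B : {set 'I_n} | (#|B| == k) && [forall i, gale_le i (J i) B]].

Definition word w : seq 'I_n := [seq w i | i <- enum 'I_n].

(* For i = n - 1 (the paper's n) the successor is 0 (the paper's 1), and the
   condition says that 1 occurs to the left of n. *)
Definition cDesL (s : seq 'I_n) : {set 'I_n} :=
  [set i | (index (ordS i) s < index i s)%N].

Definition rot_ending r (s : seq 'I_n) : seq 'I_n := rot (index r s).+1 s.

Definition Iset r w : {set 'I_n} := cDesL (rot_ending r (word w)).

Definition Dset k J : {set {perm 'I_n}} :=
  [set w : {perm 'I_n} |
    [&& [forall i : 'I_n, (i.+1 == n) ==> (w i == i)],
        #|cDesL (word w)| == k
      & [forall r, forall j, gale_le j (J j) (Iset r w)]]].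

End Combinatorics.

Section Matroids.
Variable T : finType.
Implicit Types (E : {set T}) (M N : {set {set T}}).

(* M is the family of bases of a matroid on the ground set E. *)
Definition is_matroid E M : Prop :=
  [/\ M != finset.set0,
      forall B, B \in M -> B \subset E
    & forall A B, A \in M -> B \in M -> forall a, a \in A :\: B ->
        exists2 b, b \in B :\: A & b |: (A :\ a) \in M].

Definition direct_sum M N : {set {set T}} := [set A :|: B | A in M, B in N].

(* Connectedness of a matroid on the whole of T, given by its bases. *)
Definition matroid_connected M : Prop :=
  ~ exists E1 E2 M1 M2,
      [/\ E1 != finset.set0, E2 != finset.set0, E1 :&: E2 = finset.set0
        & E1 :|: E2 = [set: T]%SET] /\
      [/\ is_matroid E1 M1, is_matroid E2 M2 & M = direct_sum M1 M2].

End Matroids.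

Section Polytopes.
Variables (R : realType) (n : nat).
Implicit Types (P Q F : set 'rV[R]_n).

Definition conv_hull (I : finType) (A : {set I}) (v : I -> 'rV[R]_n) :
    set 'rV[R]_n :=
  [set x | exists a : I -> R,
     [/\ forall i, i \in A -> 0 <= a i, \sum_(i in A) a i = 1
       & x = \sum_(i in A) a i *: v i]]%classic.

Definition indicator_vec (B : {set 'I_n}) : 'rV[R]_n := \sum_(i in B) delta_mx 0 i.

(* P is nonempty and W, the direction of its affine hull, has dimension d. *)
Definition has_dim P (d : nat) : Prop :=
  (P !=set0)%classic /\
  exists W : {vspace 'rV[R]_n},
    [/\ \dim W = d,
        forall x y, P x -> P y -> x - y \in W
      & forall U : {vspace 'rV[R]_n},
          (forall x y, P x -> P y -> x - y \in U) -> (W <= U)%VS].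

Definition is_face P F : Prop :=
  exists (c : 'I_n -> R) (b : R),
    (forall x, P x -> \sum_i c i * x 0 i <= b) /\
    F = [set x | P x /\ \sum_i c i * x 0 i = b]%classic.

(* The empty facet of a point is not included. *)
Definition is_facet P F : Prop :=
  is_face P F /\ exists d, has_dim P d.+1 /\ has_dim F d.

Definition share_facet P Q : Prop := exists F, is_facet P F /\ is_facet Q F.

Definition dilate (t : nat) P : set 'rV[R]_n := [set t%:R *: x | x in P]%classic.

(* #(tP \cap Z^n), for bounded P (fset_set is empty on infinite sets). *)
Definition ehrhart P (t : nat) : nat :=
  #|` fset_set [set z : 'rV[int]_n | dilate t P (map_mx intr z)]%classic|.

(* Cauchy product of formal power series, given by their coefficients. *)
Definition fps_mul (a b : nat -> int) (m : nat) : int :=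
  \sum_(i < m.+1) a i * b (m - i)%N.

(* (1 - z)^(d+1) * \sum_t #(tP \cap Z^n) z^t = h, where d is the dimension
   of P. *)
Definition is_hstar P (h : {poly int}) : Prop :=
  exists2 d, has_dim P d &
    forall m, fps_mul (fun i => ((1 - 'X) ^+ d.+1)`_i)
                      (fun t => (ehrhart P t)%:Z) m = h`_m.

End Polytopes.

Arguments indicator_vec R {n} B.

Section Posets.
Variables (R : realType) (n k : nat) (J : 'I_n -> {set 'I_n}).
Implicit Types (u v w : {perm 'I_n}).

Definition positroid_polytope : set 'rV[R]_n :=
  conv_hull (positroid_bases k J) (indicator_vec R).

Definition wsimplex w : set 'rV[R]_n :=
  conv_hull [set: 'I_n]%SET (fun r => indicator_vec R (Iset r w)).

Definition Gamma_adj u w : bool :=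
  [&& u \in Dset k J, w \in Dset k J, u != w
    & `[< share_facet (wsimplex u) (wsimplex w) >]].

(* The vertices of the path are u :: p. *)
Definition shortest_path u v (p : seq {perm 'I_n}) : Prop :=
  [/\ path Gamma_adj u p, last u p = v
    & forall q, path Gamma_adj u q -> last u q = v -> (size p <= size q)%N].

Definition prec w0 u v : Prop :=
  [/\ u \in Dset k J, v \in Dset k J, u != v
    & exists2 p, shortest_path w0 v p & u \in w0 :: p].

Definition covers w0 w u : Prop :=
  prec w0 u w /\ ~ exists x, prec w0 u x /\ prec w0 x w.

Definition cover_num w0 w : nat := #|[set u | `[< covers w0 w u >]]%SET|.

End Posets.

Arguments positroid_polytope R {n} k J.
Arguments wsimplex R {n} w.

(* Main.v *)
(** In the heights [x_1 + ... + x_i], the simplices [Delta_(w)] are the alcoves of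
    the affine arrangement of type A, and the positroid polytope [P] is cut out
    by hyperplanes of that arrangement.  An alcove is determined by its Shi
    coordinates, the integer parts of the height differences on its interior,
    and both membership in [D_J] and adjacency can be read off from them:
    adjacent alcoves differ in the Shi coordinate of a single hyperplane.
    Hence the distance to [w0] in [Gamma_J] is the number of hyperplanes
    separating an alcove from that of [w0], and [cover w] is the number of
    facets of [Delta_(w)] visible from the interior of [Delta_(w0)].  Pushing
    the lattice points of [t P] slightly towards that interior distributes them
    among the alcoves: [Delta_(w)] receives its lattice points off the visible
    facets, and as it is unimodular this half-open simplex contributes
    [z ^ cover w / (1 - z) ^ n] to the Ehrhart series. *)
Require Import Defs.
From mathcomp Require Import all_boot all_order all_algebra all_fingroup.
From mathcomp Require Import zify ring.
From mathcomp Require Import finmap.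
From mathcomp Require Import boolp classical_sets cardinality reals.
Set Implicit Arguments.
Unset Strict Implicit.
Unset Printing Implicit Defensive.
Import Order.TTheory GRing.Theory Num.Theory.
Local Open Scope ring_scope.

(** * Positions, descents and Shi coordinates *)

(** What keeps the distance argument inside D_J: membership is one strict upper bound on each Shi
    coordinate, and crossing a visible wall raises a single coordinate, to at most its value at
    [w0]. The bound survives because [w0] satisfies it, so every [w] can descend to [w0] within D_J.
    The triangulation of P is not presupposed; it is established as far as counting requires it. The
    bounds hold at the bases, hence on t P, so a perturbed lattice point of t P lies in an alcove of
    D_J; conversely the vertices of such an alcove are bases. Alcoves are handled over the integers
    by clearing denominators, and real numbers enter only through hulls, faces and dimensions. *)

Section WordOrder.
Variable N : nat.
Local Notation n := N.+1.
Implicit Types (i j l r s : 'I_n) (w u v : {perm 'I_n}).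

Definition pos w i : 'I_n := (w^-1)%g i.

Lemma posK w : cancel (pos w) w.
Proof. by move=> i; rewrite /pos permKV. Qed.

Lemma pos_perm w i : pos w (w i) = i.
Proof. by rewrite /pos permK. Qed.

Lemma pos_inj w : injective (pos w).
Proof. exact: perm_inj. Qed.

Lemma index_word w i : index i (word w) = pos w i.
Proof.
by rewrite -{1}(posK w i) /word index_map ?index_enum_ord //; apply: perm_inj.
Qed.

Lemma word_uniq w : uniq (word w).
Proof. by rewrite map_inj_uniq ?enum_uniq //; apply: perm_inj. Qed.

Lemma size_word w : size (word w) = n.
Proof. by rewrite size_map size_enum_ord. Qed.

Lemma mem_word w i : i \in word w.
Proof. by rewrite -index_mem index_word size_word. Qed.

Lemma index_rot_word w r i :
  index i (rot_ending r (word w)) =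
  if (pos w r < pos w i)%N then (pos w i - (pos w r).+1)%N
  else (pos w i + (n - (pos w r).+1))%N.
Proof.
rewrite /rot_ending index_word /rot.
set m := (pos w r).+1.
have lm : (m <= size (word w))%N by rewrite size_word /m ltn_ord.
have iE := index_word w i.
have it : (i \in take m (word w)) = (pos w i < m)%N.
  by rewrite in_take_leq // iE.
have U := word_uniq w; have iw := mem_word w i.
rewrite -(cat_take_drop m (word w)) cat_uniq mem_cat in U iw iE.
case/and3P: U => _ /hasPn U _.
rewrite index_cat; case: ifP => [id|idF].
  have nit := U _ id; rewrite it in nit.
  have -> : (pos w r < pos w i)%N by move: nit; rewrite /m; lia.
  by rewrite -iE index_cat it (negbTE nit) size_take_min (minn_idPl lm) addKn.
rewrite idF orbF it in iw.
have -> : (pos w r < pos w i)%N = false by move: iw; rewrite /m; lia.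
by rewrite size_drop size_word -iE index_cat it iw addnC.
Qed.

Definition desc w l : bool := (pos w (ordS l) < pos w l)%N.

Lemma desc_cDesL w l : (l \in cDesL (word w)) = desc w l.
Proof. by rewrite inE !index_word. Qed.

(** Making the word end with [r] moves the letters up to [r] behind the others. The descent
    indicator changes by the difference of one function between [ordS l] and [l], so the change
    telescopes in heights and cardinalities. *)
Lemma Iset_desc w r l :
  (l \in Iset r w)%:Z =
  (desc w l)%:Z + (pos w r < pos w (ordS l))%:Z - (pos w r < pos w l)%:Z :> int.
Proof.
rewrite inE !index_rot_word /desc.
have := ltn_ord (pos w (ordS l)); have := ltn_ord (pos w l).
have := ltn_ord (pos w r).
by do 2 case: ifP => ?; lia.
Qed.

(** The sum stops before [i], so the heights start at 0; the total enters only at the wrap-around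
    from [ord_max] to [ord0]. *)
Definition psum (x : 'I_n -> int) i : int := \sum_(l < n | (l < i)%N) x l.

Lemma psum0 x : psum x ord0 = 0.
Proof. by rewrite /psum big_pred0. Qed.

Lemma val_ordS l : l != ord_max -> ordS l = l.+1 :> nat.
Proof.
rewrite -(inj_eq val_inj) /= => h; rewrite modn_small //.
by have := ltn_ord l; lia.
Qed.

Lemma ordS_max : ordS (ord_max : 'I_n) = ord0.
Proof. by apply/val_inj; rewrite /= modnn. Qed.

Lemma psumS x l : l != ord_max -> psum x (ordS l) = psum x l + x l.
Proof.
move=> h; rewrite /psum (bigD1 l) ?val_ordS //= addrC; congr (_ + _).
by apply: eq_bigl => i; rewrite -(inj_eq val_inj) /=; lia.
Qed.

Lemma psum_max x : psum x ord_max + x ord_max = \sum_l x l.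
Proof.
rewrite /psum [RHS](bigD1 (ord_max : 'I_n)) //= addrC; congr (_ + _).
apply: eq_bigl => i; have := ltn_ord i; rewrite -(inj_eq val_inj) /=; lia.
Qed.

Lemma psum_uniq (f x : 'I_n -> int) :
  f ord0 = 0 -> (forall l, l != ord_max -> f (ordS l) = f l + x l) ->
  f =1 psum x.
Proof.
move=> f0 fS i; have [m mi] : exists m, (i : nat) = m by exists i.
elim: m i mi => [|m IH] i mi.
  have -> : i = ord0 by apply/val_inj.
  by rewrite psum0.
have lm : (m < n)%N by have := ltn_ord i; lia.
have hm : Ordinal lm != ord_max.
  by rewrite -(inj_eq val_inj) /=; have := ltn_ord i; lia.
have -> : i = ordS (Ordinal lm) by apply: ord_inj; rewrite (val_ordS hm) mi.
by rewrite fS // psumS // IH.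
Qed.

Lemma psumE (g y : 'I_n -> int) x :
  (forall l, x l = g (ordS l) - g l + y l) ->
  forall i, psum x i = g i - g ord0 + psum y i.
Proof.
move=> xE i; symmetry; move: i; apply: psum_uniq; first by rewrite psum0; lia.
by move=> l h; rewrite xE psumS //; lia.
Qed.

Lemma psum_cyc x l :
  psum x (ordS l) - psum x l + (l == ord_max)%:Z * \sum_l x l = x l.
Proof.
have [->|h] := eqVneq l ord_max; last by rewrite psumS //; lia.
by rewrite ordS_max psum0 -psum_max; lia.
Qed.

Lemma sum_ordSB (g : 'I_n -> int) : \sum_l (g (ordS l) - g l) = 0.
Proof.
rewrite sumrB; apply/eqP; rewrite subr_eq0; apply/eqP; symmetry.
by rewrite (reindex_inj (@ordS_inj n)).
Qed.

Lemma psum_sum (I : finType) (P : pred I) (F : I -> 'I_n -> int) i :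
  psum (fun l => \sum_(r | P r) F r l) i = \sum_(r | P r) psum (F r) i.
Proof. by rewrite /psum exchange_big. Qed.

(* Shi coordinates: with the lift [a i = pos w i + n * hgt w i] of the
   positions, [shi w i j] is the integer part of [(a i - a j) / n]. *)
Definition hgt w i : int := psum (fun l => (desc w l)%:Z) i.
Definition shi w i j : int := hgt w i - hgt w j - (pos w i < pos w j)%:Z.

Definition lift_pos w i : int := (pos w i)%:Z + n%:Z * hgt w i.

(** The point with heights [u / m] lies in the open alcove of [w]. *)
Definition has_shi (u : 'I_n -> int) (m : int) w : Prop :=
  forall i j, i != j -> m * shi w i j < u i - u j < m * (shi w i j + 1).

Lemma pos_neq w i j : i != j -> (pos w i == pos w j :> nat) = false.
Proof. by move=> h; apply/negbTE; rewrite (inj_eq val_inj) (inj_eq (@pos_inj w)). Qed.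

Lemma shi_lift w : has_shi (lift_pos w) n w.
Proof.
move=> i j h; rewrite /shi /lift_pos; have := pos_neq w h.
have := ltn_ord (pos w i); have := ltn_ord (pos w j).
set A := hgt w i; set B := hgt w j; move=> hj hi hn.
by case: ltnP => hij /=; apply/andP; split; nia.
Qed.

Lemma shi_anti w i j : i != j -> shi w i j = -1 - shi w j i.
Proof. by move=> h; rewrite /shi; have := pos_neq w h; lia. Qed.

Lemma shi_refl w i : shi w i i = 0.
Proof. by rewrite /shi ltnn; lia. Qed.

Lemma hgt_bound w i : 0 <= hgt w i <= n%:Z.
Proof.
rewrite /hgt /psum sumr_ge0 //=; apply: (@le_trans _ _ (\sum_(l < n | (l < i)%N) 1)).
  by apply: ler_sum => l _; case: desc.
by rewrite sumr_const -natz ler_nat (leq_trans (max_card _)) ?card_ord.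
Qed.

Lemma shi_bound w i j : - n%:Z - 1 <= shi w i j <= n%:Z.
Proof. by rewrite /shi; have := hgt_bound w i; have := hgt_bound w j; lia. Qed.

Lemma Iset_psum w r i :
  psum (fun l => (l \in Iset r w)%:Z) i =
  hgt w i + (pos w r < pos w i)%:Z - (pos w r < pos w ord0)%:Z.
Proof.
rewrite (psumE (g := fun i => (pos w r < pos w i)%:Z) (y := fun l => (desc w l)%:Z)).
  by rewrite /hgt; lia.
by move=> l; rewrite Iset_desc; lia.
Qed.

Lemma card_psum (S : {set 'I_n}) : #|S|%:Z = \sum_l (l \in S)%:Z.
Proof.
rewrite -sum1_card -natz natr_sum big_mkcond /=.
by apply: eq_bigr => i _; case: (i \in S).
Qed.

Lemma card_Iset w r : #|Iset r w|%:Z = \sum_l (desc w l)%:Z.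
Proof.
pose g i := (pos w r < pos w i)%:Z.
rewrite card_psum -[RHS]addr0 -[X in _ = _ + X](sum_ordSB g) -big_split /=.
by apply: eq_bigr => l _; rewrite Iset_desc /g; lia.
Qed.

Lemma card_cDesL w : #|cDesL (word w)|%:Z = \sum_l (desc w l)%:Z.
Proof. by rewrite card_psum; apply: eq_bigr => l _; rewrite desc_cDesL. Qed.

Definition next w r : 'I_n := w (ordS (pos w r)).

Lemma pos_next w r : pos w (next w r) = ordS (pos w r).
Proof. by rewrite pos_perm. Qed.

(** The left side is the height difference of [s] and [r] at the vertex [Iset i w]. As [s] follows
    [r] immediately in the cyclic word, all vertices but [Iset r w] lie on one wall, and that one is
    1 above it: the form is a barycentric coordinate. *)
Lemma Iset_next_psum w r s i :
  (0 < N)%N -> s = next w r -> 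
  hgt w s + (pos w i < pos w s)%:Z - hgt w r - (pos w i < pos w r)%:Z
   = shi w s r + (i == r)%:Z.
Proof.
move=> N0 ->; rewrite /shi -(inj_eq (@pos_inj w)) !pos_next.
have [e|h] := eqVneq (pos w r) ord_max.
  rewrite !e ordS_max /= -(inj_eq val_inj) /=; have := ltn_ord (pos w i); lia.
by rewrite !val_ordS // -(inj_eq val_inj) /=; lia.
Qed.

(** The heights telescope around the cyclic word, and only the step from its last letter to its
    first counts. This normalises the barycentric coordinates. *)
Lemma sum_shi_next w : (0 < N)%N -> \sum_r shi w (next w r) r = -1.
Proof.
move=> N0.
have nextE : next w =1 (w \o @ordS n) \o pos w by [].
have -> : \sum_r shi w (next w r) r =
  \sum_q (hgt w (w (ordS q)) - hgt w (w q) - (ordS q < q)%N%:Z).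
  rewrite (reindex_inj (@perm_inj _ w)); apply: eq_bigr => q _.
  by rewrite /shi pos_next !pos_perm /next pos_perm.
rewrite sumrB (sum_ordSB (fun q => hgt w (w q))) sub0r; congr (- _).
rewrite (bigD1 (ord_max : 'I_n)) //= modnn big1 ?addr0 => [|q hq].
  by rewrite N0.
by rewrite (_ : ((ordS q : nat) < q)%N = false) ?val_ordS //; lia.
Qed.

End WordOrder.

(** * Recovering an alcove from a point *)

Section ShiCoordinates.
Variable N : nat.
Local Notation n := N.+1.
Implicit Types (i j l r s : 'I_n) (w u v : {perm 'I_n}).

(** The n walls of an alcove imply all its other bounds: once [m * hgt] is removed, [u] increases
    along the word, with total gain less than [m]. *)
Lemma shi_sorted (u : 'I_n -> int) (m : int) w :
    (0 < N)%N -> 0 < m ->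
    (forall r, m * shi w (next w r) r < u (next w r) - u r) ->
  has_shi u m w.
Proof.
move=> N0 m0 hu.
pose c q := u (w q) - m * hgt w (w q).
have cS q : q != ord_max -> c q < c (ordS q).
  move=> hq; have := hu (w q); rewrite /shi pos_next !pos_perm /next pos_perm /c.
  by rewrite (_ : (ordS q < q)%N = false) ?val_ordS //; nia.
have cmax : c ord_max < c ord0 + m.
  have := hu (w ord_max); rewrite /shi pos_next !pos_perm /next pos_perm ordS_max /c.
  by rewrite (_ : (ord0 < ord_max)%N = true) //; nia.
have c_lt (d : nat) : forall p q : 'I_n, (p + d.+1)%N = q -> c p < c q.
  elim: d => [|d IH] p q pq.
    have hp : p != ord_max by rewrite -(inj_eq val_inj) /=; have := ltn_ord q; lia.
    have -> : q = ordS p by apply: ord_inj; rewrite val_ordS //; lia.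
    exact: cS.
  have hp : p != ord_max by rewrite -(inj_eq val_inj) /=; have := ltn_ord q; lia.
  by apply: lt_trans (cS _ hp) (IH _ _ _); rewrite val_ordS //; lia.
have c_mono (p q : 'I_n) : (p < q)%N -> c p < c q.
  by move=> pq; apply: (c_lt (q - p.+1)%N); lia.
have c_max q : c q <= c ord_max.
  have [->//|h] := eqVneq q ord_max; apply/ltW/c_mono.
  by move: h; rewrite -(inj_eq val_inj) /=; have := ltn_ord q; lia.
have c_min q : c ord0 <= c q.
  have [->//|h] := eqVneq q ord0; apply/ltW/c_mono.
  by move: h; rewrite -(inj_eq val_inj) /=; lia.
move=> i j hij; have := pos_neq w hij.
have := c_max (pos w i); have := c_min (pos w i).
have := c_max (pos w j); have := c_min (pos w j).
have := @c_mono (pos w i) (pos w j); have := @c_mono (pos w j) (pos w i).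
have cE l : c (pos w l) = u l - m * hgt w l by rewrite /c posK.
rewrite !cE /shi; move: (c ord0) (c ord_max) cmax => c0 c1 cmax h1 h2 h3 h4 h5 h6 h7.
rewrite !mulrDr !mulrN mulr1.
case: ltnP => h8 /=.
  by have := h2 h8; rewrite mulr1; lia.
have h9 : (pos w j < pos w i)%N by lia.
by have := h1 h9; rewrite mulr0; lia.
Qed.

Lemma psum_const1 i : psum (fun=> 1) i = i%:Z.
Proof.
symmetry; move: i; apply: psum_uniq => // l h.
by rewrite val_ordS // -addn1 PoszD.
Qed.

Lemma pos_rank w i : (pos w i)%:Z = \sum_j (pos w j < pos w i)%:Z.
Proof.
rewrite -psum_const1 /psum big_mkcond /= (reindex_inj (@pos_inj _ w)) /=.
by apply: eq_bigr => j _; case: ltnP.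
Qed.

Lemma perm_pos_inj w u :
  (forall i j, (pos w i < pos w j)%N = (pos u i < pos u j)%N) -> w = u.
Proof.
move=> h; have e i : pos w i = pos u i.
  apply: val_inj; apply/eqP; rewrite -eqz_nat !pos_rank; apply/eqP.
  by apply: eq_bigr => j _; rewrite h.
by apply/permP => q; rewrite -{2}(pos_perm w q) e posK.
Qed.

(** Since [ord_max] comes last, [shi w i ord_max] gives [hgt w i] up to a constant; what then
    remains of [shi w i j] is the relative order of [i] and [j]. *)
Lemma perm_shi_inj w u :
    w ord_max = ord_max -> u ord_max = ord_max ->
    (forall i j, i != j -> shi w i j = shi u i j) ->
  w = u.
Proof.
move=> hw hu e.
have pw : pos w ord_max = ord_max by rewrite -{1}hw pos_perm.
have pu : pos u ord_max = ord_max by rewrite -{1}hu pos_perm.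
apply: perm_pos_inj => i j.
have [->|ij] := eqVneq i j; first by rewrite !ltnn.
have lt_max v l : pos v ord_max = ord_max -> l != ord_max -> (pos v l < N)%N.
  move=> pv hl; have := pos_neq v hl; rewrite pv /=; have := ltn_ord (pos v l); lia.
have [->|hi] := eqVneq i ord_max.
  by rewrite pw pu /=; have := ltn_ord (pos w j); have := ltn_ord (pos u j); lia.
have [->|hj] := eqVneq j ord_max.
  by rewrite pw pu /= !lt_max.
have := e i j ij; have := e i ord_max hi; have := e j ord_max hj.
rewrite /shi pw pu /= !lt_max //; lia.
Qed.

Lemma has_shi_uniq (x : 'I_n -> int) m w u :
    0 < m -> has_shi x m w -> has_shi x m u ->
  forall i j, i != j -> shi w i j = shi u i j.
Proof.
move=> m0 hw hu i j ij; have /andP[a b] := hw i j ij; have /andP[c d] := hu i j ij.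
have h1 : m * shi w i j < m * (shi u i j + 1) by apply: lt_trans d.
have h2 : m * shi u i j < m * (shi w i j + 1) by apply: lt_trans b.
move: h1 h2; rewrite !ltr_pM2l //; lia.
Qed.

Lemma perm_of_key (key : 'I_n -> int) :
  injective key ->
  exists w, forall i j, (pos w i < pos w j)%N = (key i < key j).
Proof.
move=> key_inj; pose below i := [set j | key j < key i].
have rk_lt i : (#|below i| < n)%N.
  rewrite -[X in (_ < X)%N](card_ord n) -cardsT; apply: proper_card.
  by apply/properP; split; [exact: finset.subsetT | exists i; rewrite ?inE ?ltxx].
pose rk i := Ordinal (rk_lt i).
have rk_mono i j : key i < key j -> (rk i < rk j)%N.
  move=> ij; apply: proper_card; apply/properP; split.
    by apply/fintype.subsetP => l; rewrite !inE => /lt_trans; apply.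
  by exists i; rewrite !inE ?ltxx.
have rk_inj : injective rk.
  move=> i j e; apply: key_inj; apply/eqP; rewrite eq_le !leNgt.
  by apply/andP; split; apply/negP => /rk_mono; rewrite e ltnn.
exists ((perm rk_inj)^-1)%g => i j.
rewrite /pos invgK !permE; apply/idP/idP => [|/rk_mono//].
by apply: contraLR; rewrite -leNgt le_eqVlt -leqNgt => /predU1P[/key_inj->//|/rk_mono/ltnW].
Qed.

(** The alcove of a generic point is read off modulo [m]: sorted residues give the word, quotients
    the heights. The last hypothesis puts each coordinate strictly between 0 and 1, which makes the
    quotient steps 0 or 1, as descents must be. *)
Lemma exists_perm_shi (u : 'I_n -> int) (m k : int) :
    0 < m ->
    (forall i j, i != j -> ~~ (m %| u i - u j)%Z) ->
    (forall l, 0 < u (ordS l) - u l + (l == ord_max)%:Z * (m * k) < m) ->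
  exists w, [/\ w ord_max = ord_max, \sum_l (desc w l)%:Z = k & has_shi u m w].
Proof.
move=> m0 u_inj uS.
(* The shift gives [ord_max] the largest residue, [m - 1], so that it becomes the last letter. *)
pose x i := u i - u ord_max - 1.
pose key i := (x i %% m)%Z; pose q i := (x i %/ m)%Z.
have xE i : u i = q i * m + key i + u ord_max + 1.
  by rewrite /q /key -divz_eq /x; lia.
have key_ge i : 0 <= key i by rewrite modz_ge0 // gt_eqF.
have key_lt i : key i < m by rewrite ltz_pmod.
have key_inj : injective key.
  move=> i j e; apply/eqP; apply: contraTT isT => ij.
  have := u_inj i j ij; rewrite (xE i) (xE j) e.
  by rewrite (_ : _ - _ = (q i - q j) * m) ?dvdz_mull //; ring.
have [w wE] := perm_of_key key_inj.
have dE l : (desc w l)%:Z = q (ordS l) - q l + (l == ord_max)%:Z * k.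
  have := uS l; rewrite (xE (ordS l)) (xE l) /desc wE.
  have := key_ge l; have := key_ge (ordS l); have := key_lt l; have := key_lt (ordS l).
  set a := key l; set b := key (ordS l); set p := q l; set p' := q (ordS l).
  set e := (_ == _)%:Z; set D := p' - p + e * k.
  rewrite (_ : _ + e * (m * k) = m * D + (b - a)); last by rewrite /D; ring.
  move: D => D {uS xE} h1 h2 h3 h4 /andP[h5 h6].
  have h7 : m * D < m * 2 by lia.
  have h8 : m * (-1) < m * D by lia.
  rewrite !ltr_pM2l // in h7 h8.
  have : D = 0 \/ D = 1 by lia.
  by case: (ltP b a) => hab [] h9 //; subst D; exfalso; move: h5 h6 hab; lia.
have hE i : hgt w i = q i - q ord0.
  symmetry; move: i; apply: psum_uniq => [|l hl]; first by rewrite subrr.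
  by rewrite dE (negbTE hl); lia.
exists w; split.
- have key_max : key ord_max = m - 1.
    rewrite /key /x subrr sub0r (_ : -1 = (-1) * m + (m - 1)); last by ring.
    by rewrite modzMDl modz_small //; lia.
  set i := w ord_max; apply/eqP; apply: contraTT isT => hi.
  have : key i < key ord_max.
    by rewrite lt_neqAle (inj_eq key_inj) hi key_max; have := key_lt i; lia.
  by rewrite -wE pos_perm /= ltnNge -ltnS ltn_ord.
- rewrite (eq_bigr _ (fun l _ => dE l)) big_split /= sum_ordSB add0r -mulr_suml.
  by rewrite (bigD1 ord_max) //= eqxx big1 ?addr0 ?mul1r // => l /negbTE->.
move=> i j ij; rewrite /shi !hE (xE i) (xE j) wE.
have := key_ge i; have := key_ge j; have := key_lt i; have := key_lt j.
have : key i != key j by rewrite (inj_eq key_inj).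
set a := key i; set b := key j; move=> h1 h2 h3 h4 h5.
rewrite (_ : q i * m + _ + _ + _ - _ = m * (q i - q j) + (a - b)); last by ring.
rewrite (_ : q i - _ - _ = q i - q j); last by ring.
rewrite !mulrDr !mulrN; move: (m * q i) (m * q j) => A B.
by case: (ltP a b) => h6 /=; rewrite ?mulr1 ?mulr0; apply/andP; split; lia.
Qed.

End ShiCoordinates.

(** * The Gale order *)

(* [P] is a queue of elements of the first sequence still to be matched; only
   the fact that they precede everything in [s] matters. *)
Lemma all2_filter_prefix (T : eqType) (e : rel T) (S1 S2 : pred T) (s P : seq T) :
    reflexive e -> pairwise (fun x y => e x y && ~~ e y x) s -> allrel e P s ->
  all2 e (P ++ filter S1 s) (filter S2 s) <->
  (size P + count S1 s)%N = count S2 s /\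
  forall m, (count S2 (take m s) <= size P + count S1 (take m s))%N.
Proof.
move=> e_refl; elim: s P => [|x s IH] P /=.
  rewrite cats0; case: P => [|p P] _ _ /=; last by split=> // -[].
  by split=> // _; split.
case/andP=> /allP xs pw; rewrite allrel_consr => /andP[/allP Px Ps].
have cons_take (Q : nat -> seq T -> Prop) :
    (forall m, Q m (take m (x :: s))) <-> Q 0%N [::] /\ forall m, Q m.+1 (x :: take m s).
  by split=> [H|[H0 H] [|m]//]; split; [exact: (H 0%N)|move=> m; exact: (H m.+1)].
have xx : allrel e [:: x] s.
  by rewrite allrel1l; apply/allP => y /xs /andP[].
rewrite (cons_take (fun _ t => (count S2 t <= size P + count S1 t)%N)) /=.
case S2x: (S2 x); case S1x: (S1 x) => /=.
- case: P Px Ps {cons_take} => [|p P] Px Ps /=.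
    rewrite e_refl (IH [::] pw (allrel0l _ _)) /=; split=> -[h1 h2]; split; try lia.
      by split=> // m; have := h2 m; lia.
    by case: h2 => _ h2 m; have := h2 m; lia.
  rewrite Px ?mem_head //= -cat_rcons IH //; last first.
    by rewrite -cats1 allrel_catl xx andbT; move: Ps; rewrite allrel_consl => /andP[].
  rewrite size_rcons; split=> -[h1 h2]; split; try lia.
    by split=> // m; have := h2 m; lia.
  by case: h2 => _ h2 m; have := h2 m; lia.
- case: P Px Ps {cons_take} => [|p P] Px Ps /=.
    (* Empty queue, [x] only in the second sequence: both sides fail, since nothing up to [x] in the
       first can match it. *)
    split=> [|[_ [_ h2]]]; last by have := h2 0%N; rewrite take0 /=; lia.
    case E : (filter S1 s) => [|y s'] //=.
    have /[!mem_filter]/andP[_ ys] : y \in filter S1 s by rewrite E mem_head.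
    by have /andP[_ /negbTE->] := xs y ys.
  rewrite Px ?mem_head //= IH //; last first.
    by move: Ps; rewrite allrel_consl => /andP[].
  split=> -[h1 h2]; split; try lia.
    by split=> // m; have := h2 m; lia.
  by case: h2 => _ h2 m; have := h2 m; lia.
- rewrite -cat_rcons IH //; last by rewrite -cats1 allrel_catl xx andbT.
  rewrite size_rcons; split=> -[h1 h2]; split; try lia.
    by split=> // m; have := h2 m; lia.
  by case: h2 => _ h2 m; have := h2 m; lia.
- rewrite IH //; split=> -[h1 h2]; split; try lia.
    by split=> // m; have := h2 m; lia.
  by case: h2 => _ h2 m; have := h2 m; lia.
Qed.

Section Gale.
Variable N : nat.
Local Notation n := N.+1.
Implicit Types (i j l r s : 'I_n) (w u v : {perm 'I_n}) (S T B : {set 'I_n}).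
Implicit Types (x : 'I_n -> int) (k : nat) (J : 'I_n -> {set 'I_n}).

Lemma cyc_enum_uniq j : uniq (cyc_enum j).
Proof. by rewrite rot_uniq enum_uniq. Qed.

Lemma size_cyc_enum j : size (cyc_enum j) = n.
Proof. by rewrite size_rot size_enum_ord. Qed.

Lemma sum_take_enum x l : \sum_(i <- take l (enum 'I_n)) x i = psum x l.
Proof.
pose f (l : 'I_n) := \sum_(i <- take l (enum 'I_n)) x i.
rewrite -/(f l); move: l; apply: psum_uniq => [|l hl]; first by rewrite /f take0 big_nil.
rewrite /f val_ordS // (take_nth ord0) ?size_enum_ord //.
by rewrite nth_ord_enum -cats1 big_cat big_seq1.
Qed.

Lemma sum_take_cyc_enum x j l :
  \sum_(i <- take (index l (cyc_enum j)) (cyc_enum j)) x i =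
  psum x l - psum x j + (l < j)%:Z * \sum_i x i.
Proof.
have tot : \sum_i x i = psum x j + \sum_(i <- drop j (enum 'I_n)) x i.
  by rewrite -sum_take_enum -big_cat cat_take_drop big_enum.
have U := enum_uniq 'I_n.
have il : index l (enum 'I_n) = l by rewrite index_enum_ord.
have lE : l \in enum 'I_n by rewrite mem_enum.
have lt : (l \in take j (enum 'I_n)) = (l < j)%N.
  by rewrite in_take_leq ?il // size_enum_ord ltnW.
rewrite -(cat_take_drop j (enum 'I_n)) in U il lE.
move: U il lE; rewrite cat_uniq mem_cat index_cat => /and3P[_ /hasPn U _].
rewrite lt size_take size_enum_ord ltn_ord /cyc_enum /rot index_cat.
case: ltnP => lj /=; move=> il lE.
  have ld : l \notin drop j (enum 'I_n).
    by apply/negP => /U; rewrite lt lj.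
  rewrite (negbTE ld) il take_cat ltnNge leq_addr /= addKn take_takel ?(ltnW lj) //.
  by rewrite big_cat /= sum_take_enum tot mul1r; ring.
have -> : index l (drop j (enum 'I_n)) = (l - j)%N by rewrite -[X in (X - _)%N]il addKn.
rewrite lE take_cat size_drop size_enum_ord.
have -> : (l - j < n - j)%N by have := ltn_ord l; lia.
rewrite mul0r addr0 -(sum_take_enum x l) -{2}(subnKC lj) takeD big_cat /=.
by rewrite sum_take_enum addrAC subrr add0r.
Qed.

Lemma count_sum (s : seq 'I_n) S : (count (mem S) s)%:Z = \sum_(i <- s) (i \in S)%:Z.
Proof. by elim: s => [|a s IH]; rewrite ?big_nil // big_cons /= PoszD IH. Qed.

Lemma count_cyc_enum j S : count (mem S) (cyc_enum j) = #|S|.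
Proof.
rewrite (seq.permP (_ : perm_eq _ (enum 'I_n))) ?perm_rot //.
by rewrite -size_filter cardE /enum_mem -filter_predI; congr (size _); apply: eq_filter => i /=; rewrite andbT.
Qed.

Definition ipsum S i : int := psum (fun l => (l \in S)%:Z) i.

(** Pointwise comparison amounts to comparing counts on initial segments of the j-order. A segment
    that wraps around adds the whole cardinality, which cancels when the cardinalities agree. *)
Lemma gale_leP j S T :
  gale_le j S T <->
  #|S| = #|T| /\ forall l, ipsum T l - ipsum T j <= ipsum S l - ipsum S j.
Proof.
have h := @all2_filter_prefix _ (cyc_le j) (mem S) (mem T) (cyc_enum j) [::].
rewrite /gale_le /cyc_sort -[X in all2 _ X]cat0s h ?allrel0l //; first last.
- apply/(pairwiseP j) => a b; rewrite !inE size_cyc_enum => ha hb ab.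
  by rewrite /cyc_le !index_uniq ?size_cyc_enum ?cyc_enum_uniq //; lia.
- by move=> i; rewrite /cyc_le.
rewrite !count_cyc_enum add0n; split=> -[c H]; split=> //.
  move=> l; have := H (index l (cyc_enum j)); rewrite add0n -lez_nat !count_sum.
  by rewrite !sum_take_cyc_enum -!card_psum c lerD2r.
move=> m; rewrite add0n.
case: (ltnP m (size (cyc_enum j))) => hm; last by rewrite take_oversize // !count_cyc_enum c.
have <- : index (nth j (cyc_enum j) m) (cyc_enum j) = m by rewrite index_uniq ?cyc_enum_uniq.
by rewrite -lez_nat !count_sum !sum_take_cyc_enum -!card_psum c lerD2r H.
Qed.

Definition bound J j i : int := ipsum (J j) i - ipsum (J j) j.

Lemma basesP k J B :
  B \in positroid_bases k J <->
  [/\ #|B| = k, forall j, #|J j| = k &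
      forall j l, ipsum B l - ipsum B j <= bound J j l].
Proof.
rewrite inE; split=> [/andP[/eqP cB /forallP H]|[cB cJ H]].
  by split=> // [j|j l]; have /gale_leP[h1 h2] := H j; rewrite -?cB.
by rewrite cB eqxx; apply/forallP => j; apply/gale_leP; rewrite cB cJ.
Qed.

Lemma ipsum_Iset w r i : ipsum (Iset r w) i =
  hgt w i + (pos w r < pos w i)%:Z - (pos w r < pos w ord0)%:Z.
Proof. exact: Iset_psum. Qed.

(** On the vertices of the alcove the height difference of [i] and [j] is at most [shi w i j + 1],
    with equality at [Iset j w]. So one strict bound for each pair replaces the Gale conditions on
    all vertices. *)
Lemma DsetP k J w :
  w \in Dset k J <->
  [/\ w ord_max = ord_max, \sum_l (desc w l)%:Z = k%:Z, forall j, #|J j| = k &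
      forall i j, i != j -> shi w i j < bound J j i].
Proof.
rewrite inE; split=> [/and3P[/forallP h1 /eqP h2 /forallP h3]|[h1 h2 h3 h4]].
  have hk : \sum_l (desc w l)%:Z = k%:Z by rewrite -card_cDesL h2.
  have G r j : gale_le j (J j) (Iset r w) by have /forallP := h3 r.
  split=> //.
  - by apply/eqP; have /implyP := h1 ord_max; apply.
  - by move=> j; have /gale_leP[->_] := G ord0 j; apply/eqP; rewrite -eqz_nat card_Iset hk.
  move=> i j ij; have /gale_leP[_ /(_ i)] := G j j.
  rewrite !ipsum_Iset -/(bound J j i) /shi ltnn; have := pos_neq w ij; lia.
apply/and3P; split.
- apply/forallP => i; apply/implyP => /eqP iN.
  by have -> : i = ord_max by [apply: ord_inj; case: iN]; rewrite h1.
- by rewrite -eqz_nat card_cDesL h2.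
apply/forallP => r; apply/forallP => j; apply/gale_leP; split.
  by rewrite h3; apply/eqP; rewrite -eqz_nat card_Iset h2.
move=> i; have [->|ij] := eqVneq i j; first by rewrite !subrr.
have := h4 i j ij; rewrite !ipsum_Iset -/(bound J j i) /shi; have := pos_neq w ij; lia.
Qed.

Lemma Iset_bases k J w r : w \in Dset k J -> Iset r w \in positroid_bases k J.
Proof.
rewrite inE => /and3P[_ /eqP h2 /forallP h3]; rewrite inE.
rewrite h3 andbT.
by rewrite -eqz_nat card_Iset -card_cDesL h2 eqxx.
Qed.

(** A one-letter word has no descent. With two letters or more, [next w r] differs from [r] and
    walls make sense. *)
Lemma Dset_gt0 k J w : (0 < k)%N -> w \in Dset k J -> (0 < N)%N.
Proof.
rewrite lt0n => k0; rewrite inE => /and3P[_ /eqP h2 _]; rewrite lt0n.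
apply: contraNneq k0 => N0; rewrite -h2 cards_eq0; apply/eqP/setP => i.
rewrite desc_cDesL inE /desc; have := ltn_ord (pos w (ordS i)).
by have := ltn_ord (pos w i); lia.
Qed.

End Gale.

(** * Half-open simplices and the perturbation of lattice points *)

Section Coordinates.
Variable N : nat.
Local Notation n := N.+1.
Hypothesis N0 : (0 < N)%N.
Implicit Types (i j l r s : 'I_n) (w u v : {perm 'I_n}) (S T B : {set 'I_n}).
Implicit Types (x : 'I_n -> int) (m : 'I_n -> int) (k : nat) (t : int).
Implicit Types (J : 'I_n -> {set 'I_n}).

Lemma ordS_neq l : ordS l != l.
Proof.
have [->|h] := eqVneq l ord_max; rewrite -(inj_eq val_inj) /=.
  by rewrite modnn; lia.
by have := val_ordS h => /= ->; lia.
Qed.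

Lemma next_neq w r : next w r != r.
Proof. by rewrite -(inj_eq (@pos_inj _ w)) pos_next ordS_neq. Qed.

Lemma next_inj w : injective (next w).
Proof. by move=> r s /perm_inj/ordS_inj/pos_inj. Qed.

(* [coord w t x r] is the coefficient of the vertex [e_{I_r(w)}] in the
   expansion of a point [x] with coordinate sum [t k]. *)
Definition coord w t x r : int :=
  psum x (next w r) - psum x r - t * shi w (next w r) r.

Definition comb w m l : int := \sum_r m r * (l \in Iset r w)%:Z.

Lemma psum_comb w m i : psum (comb w m) i = \sum_r m r * ipsum (Iset r w) i.
Proof. by rewrite psum_sum; apply: eq_bigr => r _; rewrite /ipsum /psum mulr_sumr. Qed.

Lemma sum_comb w m k : \sum_l (desc w l)%:Z = k%:Z ->
  \sum_l comb w m l = (\sum_r m r) * k%:Z.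
Proof.
move=> hk; rewrite exchange_big mulr_suml; apply: eq_bigr => r _ /=.
by rewrite -mulr_sumr -card_psum card_Iset hk.
Qed.

(** By [Iset_next_psum] the form [coord w 1] at [r] is 1 at the vertex [Iset r w] and 0 at the
    others. *)
Lemma coord_comb w m t r : \sum_r m r = t -> coord w t (comb w m) r = m r.
Proof.
move=> <-; rewrite /coord !psum_comb -sumrB mulr_suml -sumrB (bigD1 r) //= big1 ?addr0.
  by rewrite !ipsum_Iset; have := Iset_next_psum r N0 (erefl (next w r)); rewrite eqxx; nia.
move=> i ir; rewrite !ipsum_Iset.
have := Iset_next_psum i N0 (erefl (next w r)); rewrite (negbTE ir) -mulrBr -mulrBr.
by move=> h; apply/eqP; rewrite mulf_eq0; apply/orP; right; apply/eqP; lia.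
Qed.

Lemma sum_coord w t x : \sum_r coord w t x r = t.
Proof.
have e : \sum_r psum x (next w r) = \sum_r psum x r.
  by rewrite [RHS](reindex_inj (@next_inj w)).
by rewrite /coord !sumrB -mulr_sumr sum_shi_next // e subrr; lia.
Qed.

Lemma ordS_invariant (g : 'I_n -> int) :
  (forall q, g (ordS q) = g q) -> forall q, g q = g ord0.
Proof.
move=> gS q; apply/eqP; rewrite -subr_eq0; apply/eqP.
have -> : 0 = psum (fun=> 0) q by rewrite /psum big1.
move: q; apply: (psum_uniq (f := fun q => g q - g ord0)); first by rewrite subrr.
by move=> l _; rewrite gS addr0.
Qed.

(** This is unimodularity. Both sides agree on the wall forms, so the difference of their heights is
    constant along the word, and it vanishes at [ord0]. *)
Lemma comb_coord w t x k : \sum_l (desc w l)%:Z = k%:Z -> \sum_l x l = t * k%:Z ->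
  comb w (coord w t x) =1 x.
Proof.
move=> hk xk; set y := comb w _.
have yk : \sum_l y l = t * k%:Z by rewrite (sum_comb _ hk) sum_coord.
pose d i := psum y i - psum x i.
have dnext r : d (next w r) = d r.
  have : coord w t y r = coord w t x r by apply: coord_comb; apply: sum_coord.
  by rewrite /coord /d; lia.
have dw q : d (w (ordS q)) = d (w q) by rewrite -[RHS]dnext /next pos_perm.
have d0 i : d i = 0.
  have h := ordS_invariant dw; rewrite -(posK w i) h -(h (pos w ord0)) posK.
  by rewrite /d !psum0.
move=> l; rewrite -[LHS]psum_cyc -[RHS]psum_cyc xk yk.
by have := d0 l; have := d0 (ordS l); rewrite /d; lia.
Qed.

Variables (k : nat) (J : 'I_n -> {set 'I_n}) (w0 : {perm 'I_n}).

(* The facet of [Delta_(w)] opposite to its vertex [I_r(w)] is visible from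
   the interior of [Delta_(w0)]. *)
Definition visible w r : bool := shi w0 (next w r) r < shi w (next w r) r.

(* A lattice point [x] of [t P] is moved from [x / t] slightly towards the
   interior point [lift_pos w0 / n] of [Delta_(w0)]; heights are scaled by
   [n (pert_scale t + 1)] so that they stay integral. *)
Definition pert_scale : int := 2 * n%:Z + 3.
Definition pert x i : int := n%:Z * pert_scale * psum x i + lift_pos w0 i.
Definition pert_mod t : int := n%:Z * (pert_scale * t + 1).

Definition half_open w m := forall r, 0 <= m r /\ (visible w r -> 1 <= m r).

Lemma pert_mod_gt0 t : 0 <= t -> 0 < pert_mod t.
Proof. by move=> t0; rewrite /pert_mod /pert_scale; nia. Qed.

Lemma pertB x w t i j : pert x i - pert x j - pert_mod t * shi w i j =
  n%:Z * (pert_scale * (psum x i - psum x j - t * shi w i j)) +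
  (lift_pos w0 i - lift_pos w0 j - n%:Z * shi w i j).
Proof. by rewrite /pert /pert_mod; ring. Qed.

(** With the converse [has_shi_half_open], a half-open simplex consists of the points pushed into
    its alcove; hence these simplices are disjoint. *)
Lemma half_open_coord w t x : has_shi (pert x) (pert_mod t) w ->
  half_open w (coord w t x).
Proof.
move=> h r; have rs := next_neq w r; have /andP[h1 _] := h _ _ rs.
move: h1; rewrite -subr_gt0 pertB -/(coord w t x r) /visible.
have /andP[_] := shi_lift w0 rs.
have := shi_bound w (next w r) r; have := shi_bound w0 (next w r) r.
move: (shi w _ _) (shi w0 _ _) (coord _ _ _ _) (lift_pos _ _ - _) => K K0 m a b0 b h2 h3.
have h4 : n%:Z * (K - K0 - 1) < n%:Z * (pert_scale * m) by lia.
(* By [shi_bound], [K - K0 - 1] is at least -(2n + 2); the scale 2n + 3 exceeds this gap and so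
   rules out a negative [m]. *)
rewrite ltr_pM2l // /pert_scale in h4; split=> [|vis]; first by nia.
have : 0 < pert_scale * m by rewrite /pert_scale; lia.
by rewrite pmulr_rgt0 ?gtz0_ge1 // /pert_scale; lia.
Qed.

Lemma has_shi_half_open w t x : 0 <= t -> half_open w (coord w t x) ->
  has_shi (pert x) (pert_mod t) w.
Proof.
move=> t0 h; apply: shi_sorted => //; first exact: pert_mod_gt0.
move=> r; have rs := next_neq w r; have [] := h r.
rewrite -subr_gt0 pertB -/(coord w t x r) /visible.
have /andP[+ _] := shi_lift w0 rs.
have := shi_bound w (next w r) r; have := shi_bound w0 (next w r) r.
move: (shi w _ _) (shi w0 _ _) (coord _ _ _ _) (lift_pos _ _ - _) => K K0 m a b0 b h2 m0 vis.
case: (ltP K0 K) => [/vis m1|KK].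
  have h5 : n%:Z * (K - K0) <= n%:Z * (2 * n%:Z + 1) by rewrite ler_pM2l //; lia.
  have : n%:Z * (pert_scale * 1) <= n%:Z * (pert_scale * m).
    by rewrite ler_pM2l // ler_pM2l // /pert_scale; lia.
  by rewrite /pert_scale; lia.
have h5 : n%:Z * K <= n%:Z * K0 by rewrite ler_pM2l.
have : 0 <= n%:Z * (pert_scale * m) by rewrite !mulr_ge0 // /pert_scale; lia.
lia.
Qed.

Hypothesis w0D : w0 \in Dset k J.

(** The heights of [x] satisfy the bounds scaled by [t] weakly, the interior point of [w0] satisfies
    them strictly, and [pert] is a positive combination of the two. *)
Lemma exists_region x t : 0 <= t -> \sum_l x l = t * k%:Z ->
    (forall l, 0 <= x l <= t) ->
    (forall i j, i != j -> psum x i - psum x j <= t * bound J j i) ->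
  exists2 w, w \in Dset k J & has_shi (pert x) (pert_mod t) w.
Proof.
move=> t0 xk x01 xb; have [w0max w0k Jk w0b] := (DsetP _ _ _).1 w0D.
have M0 := pert_mod_gt0 t0.
have [|||w [h1 h2 h3]] := @exists_perm_shi _ (pert x) (pert_mod t) k%:Z.
- exact: M0.
(* Modulo n only [lift_pos w0] remains, whose differences lie strictly between consecutive multiples
   of n: the perturbed point is on no hyperplane. *)
- move=> i j ij; apply/negP => /dvdzP[q hq].
  have /andP[a b] := shi_lift w0 ij.
  have h : lift_pos w0 i - lift_pos w0 j =
      n%:Z * (q * (pert_scale * t + 1) - pert_scale * (psum x i - psum x j)).
    rewrite [RHS](_ : _ = q * pert_mod t - n%:Z * pert_scale * (psum x i - psum x j)).
      by rewrite -hq /pert; ring.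
    by rewrite /pert_mod; ring.
  by move: a b; rewrite h !ltr_pM2l //; lia.
- move=> l; have := psum_cyc x l; rewrite xk.
  have := psum_cyc (fun l => (desc w0 l)%:Z) l; rewrite w0k -!/(hgt w0 _).
  have := pos_neq w0 (ordS_neq l).
  have := ltn_ord (pos w0 l); have := ltn_ord (pos w0 (ordS l)).
  move=> p1 p2 p3 e1 e2.
  rewrite (_ : _ + _ = n%:Z * (pert_scale * x l) + ((pos w0 (ordS l))%:Z - (pos w0 l)%:Z
     + n%:Z * (desc w0 l)%:Z)); last first.
    by rewrite -{}e1 -{}e2 /pert /pert_mod /lift_pos; ring.
  have /andP[x0 xt] := x01 l.
  have h5 : 0 <= n%:Z * (pert_scale * x l) by rewrite !mulr_ge0 // /pert_scale; lia.
  have h6 : n%:Z * (pert_scale * x l) <= n%:Z * (pert_scale * t).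
    by rewrite ler_pM2l // ler_pM2l // /pert_scale; lia.
  have -> : pert_mod t = n%:Z * (pert_scale * t) + n%:Z by rewrite /pert_mod; ring.
  by move: h5 h6 p1 p2 p3; rewrite /desc; case: ltnP => /= h; rewrite ?mulr1 ?mulr0; lia.
exists w => //; apply/DsetP; split=> // i j ij.
have /andP[h4 _] := h3 i j ij; have /andP[_ h5] := shi_lift w0 ij.
rewrite -(ltr_pM2l M0); apply: lt_le_trans h4 _.
have h6 : n%:Z * (shi w0 i j + 1) <= n%:Z * bound J j i.
  by rewrite ler_pM2l //; have := w0b i j ij; lia.
have h7 : n%:Z * (pert_scale * (psum x i - psum x j)) <= n%:Z * (pert_scale * (t * bound J j i)).
  by rewrite ler_pM2l // ler_pM2l ?xb // /pert_scale; lia.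
have -> : pert_mod t * bound J j i = n%:Z * (pert_scale * (t * bound J j i)) + n%:Z * bound J j i.
  by rewrite /pert_mod; ring.
rewrite (_ : pert x i - pert x j = n%:Z * (pert_scale * (psum x i - psum x j)) + (lift_pos w0 i - lift_pos w0 j)).
  by apply: lerD => //; apply: le_trans (ltW h5) h6.
by rewrite /pert; ring.
Qed.

End Coordinates.

(** * Adjacent alcoves *)

Section Neighbours.
Variable N : nat.
Local Notation n := N.+1.
Hypothesis N0 : (0 < N)%N.
Implicit Types (i j l r s : 'I_n) (w u v : {perm 'I_n}).

(* The alcoves of [w] and [u] are exchanged by the reflection in the wall
   opposite to the vertex [I_r(w)]. *)
Definition neighbour w r u : Prop := forall i j, i != j ->
  shi u i j = shi w i j + ((i == r) && (j == next w r))%:Z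
                        - ((i == next w r) && (j == r))%:Z.

Lemma pos_next_cases w r :
  (pos w (next w r) = (pos w r).+1 :> nat /\ (pos w r < N)%N) \/
  (pos w (next w r) = 0%N :> nat /\ pos w r = N :> nat).
Proof.
rewrite pos_next; have [e|h] := eqVneq (pos w r) ord_max.
  by right; rewrite e ordS_max.
left; rewrite val_ordS //; split=> //.
by move: h; rewrite -(inj_eq val_inj) /=; have := ltn_ord (pos w r); lia.
Qed.

(** These hyperplanes bound the hypersimplex. Their Shi coordinates agree for all words with [k]
    descents, so none of them separates two alcoves. *)
Lemma shi_ordS w k l : \sum_l (desc w l)%:Z = k%:Z ->
  shi w (ordS l) l = - ((l == ord_max)%:Z * k%:Z).
Proof.
move=> hk; have := psum_cyc (fun l => (desc w l)%:Z) l.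
by rewrite hk -!/(hgt w _) /shi /desc; lia.
Qed.

Lemma lift_posB w i j : lift_pos w i - lift_pos w j =
  n%:Z * shi w i j + ((pos w i)%:Z - (pos w j)%:Z + n%:Z * (pos w i < pos w j)%:Z).
Proof. by rewrite /lift_pos /shi; ring. Qed.

(** At a shared vertex the height difference is at least [shi u i j] and at most [shi w i j + 1], so
    all vertices but [Iset r w] lie on one hyperplane. The vertices of [i] and of [next w r] rule
    out every hyperplane but the wall. *)
Lemma shares_vertices_lt w r u i j :
    (forall r', r' != r -> exists r'', Iset r' w = Iset r'' u) ->
    i != j -> shi w i j < shi u i j ->
  [/\ i = r, j = next w r & shi u i j = shi w i j + 1].
Proof.
move=> sh ij lt_ij; have nij := pos_neq w ij; have nij' := pos_neq u ij.
have V r' : r' != r -> shi u i j = shi w i j + 1 /\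
    (pos w r' < pos w i)%:Z - (pos w r' < pos w j)%:Z + (pos w i < pos w j)%:Z = 1 :> int.
  move=> /sh[r'' e]; have := ipsum_Iset w r' i; have := ipsum_Iset w r' j.
  by rewrite e !ipsum_Iset; move: lt_ij; rewrite /shi; lia.
have ns := next_neq N0 w r.
have [e _] := V _ ns.
have ir : i = r.
  by apply/eqP; apply: contraT => /V[_]; rewrite ltnn; lia.
split=> //; apply/eqP; apply: contraT => js.
have njs := pos_neq w js; have nrj : (pos w r == pos w j :> nat) = false by rewrite -ir.
have [_] := V _ ns; rewrite ir; have := ltn_ord (pos w j).
by case: (pos_next_cases w r) => -[e1 h]; move: njs; rewrite e1; lia.
Qed.

Lemma shares_vertices_neighbour w r u :
    w ord_max = ord_max -> u ord_max = ord_max -> u != w ->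
    (forall r', r' != r -> exists r'', Iset r' w = Iset r'' u) ->
  neighbour w r u.
Proof.
move=> wm um uw sh; have ns := next_neq N0 w r.
have L i j := @shares_vertices_lt w r u i j sh.
have A i j : i != j -> shi u i j < shi w i j -> i = next w r /\ j = r.
  move=> ij lt; have ji : j != i by rewrite eq_sym.
  have lt' : shi w j i < shi u j i by rewrite (shi_anti w ji) (shi_anti u ji); lia.
  by have [] := L _ _ ji lt'.
have B : shi u r (next w r) = shi w r (next w r) + 1.
  have [/existsP[i /existsP[j /andP[ij]]]|] :=
    boolP [exists i, exists j, (i != j) && (shi u i j != shi w i j)].
    rewrite neq_lt => /orP[lt|lt]; last by have [<- <-] := L _ _ ij lt.
    have [e1 e2] := A _ _ ij lt; move: lt; rewrite e1 e2.
    have rs : r != next w r by rewrite eq_sym.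
    move=> lt; have lt' : shi w r (next w r) < shi u r (next w r).
      by rewrite (shi_anti w rs) (shi_anti u rs); lia.
    by have [] := L _ _ rs lt'.
  move=> /existsPn H; case/eqP: uw; apply: perm_shi_inj => // i j ij.
  by have /existsPn/(_ j) := H i; rewrite ij /= negbK => /eqP.
have C : shi u (next w r) r = shi w (next w r) r - 1.
  by rewrite (shi_anti w ns) (shi_anti u ns) B; lia.
move=> i j ij; case: (ltgtP (shi w i j) (shi u i j)) => h.
- have [e1 e2 e3] := L _ _ ij h.
  by rewrite e3 e1 e2 !eqxx /= eq_sym (negbTE ns) /=; lia.
- have [e1 e2] := A _ _ ij h.
  by rewrite e1 e2 C !eqxx (negbTE ns) /=; lia.
- have -> : (i == r) && (j == next w r) = false.
    by apply/negP => /andP[/eqP e1 /eqP e2]; move: h; rewrite e1 e2 B; lia.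
  have -> : (i == next w r) && (j == r) = false.
    by apply/negP => /andP[/eqP e1 /eqP e2]; move: h; rewrite e1 e2 C; lia.
  by rewrite h; lia.
Qed.

Lemma neighbour_inj w r u1 u2 : u1 ord_max = ord_max -> u2 ord_max = ord_max ->
  neighbour w r u1 -> neighbour w r u2 -> u1 = u2.
Proof. by move=> m1 m2 h1 h2; apply: perm_shi_inj => // i j ij; rewrite h1 // h2. Qed.

Lemma neighbour_index_inj w r1 r2 u : neighbour w r1 u -> neighbour w r2 u -> r1 = r2.
Proof.
move=> h1 h2; have ns := next_neq N0 w r1; have := h1 _ _ ns; rewrite h2 //.
have [//|ne] := eqVneq r1 r2.
by rewrite !eqxx (negbTE ns) andbF /=; lia.
Qed.

Lemma neighbour_neq w r u : neighbour w r u -> u != w.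
Proof.
move=> h; apply/eqP => e; have ns := next_neq N0 w r; have := h _ _ ns.
by rewrite e !eqxx (negbTE ns) /=; lia.
Qed.

Lemma Iset_ext w u r r' k c :
    \sum_l (desc w l)%:Z = k%:Z -> \sum_l (desc u l)%:Z = k%:Z ->
    (forall i, ipsum (Iset r w) i = ipsum (Iset r' u) i + c) ->
  Iset r w = Iset r' u.
Proof.
move=> hw hu h; apply/setP => l.
have := psum_cyc (fun l => (l \in Iset r w)%:Z) l.
have := psum_cyc (fun l => (l \in Iset r' u)%:Z) l.
rewrite -!card_psum !card_Iset hw hu -!/(ipsum _ _) !h.
by case: (l \in Iset r w); case: (l \in Iset r' u) => //=; lia.
Qed.

Lemma ipsum_IsetB w r i :
  ipsum (Iset r w) i - ipsum (Iset r w) r = shi w i r + (i != r)%:Z.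
Proof.
rewrite !ipsum_Iset /shi ltnn; have [->|ir] := eqVneq i r; first by rewrite ltnn /=; lia.
by have := pos_neq w ir; rewrite /=; lia.
Qed.

(** The reflection swaps two consecutive letters of the cyclic word. The other vertices survive, but
    that of [next w r] is named after [r] in [u], whence the transposition. *)
Lemma neighbour_Iset w r u k r' :
    \sum_l (desc w l)%:Z = k%:Z -> \sum_l (desc u l)%:Z = k%:Z ->
    neighbour w r u -> r' != r ->
  Iset r' w = Iset (tperm r (next w r) r') u.
Proof.
move=> hw hu h r'r; have ns := next_neq N0 w r; set s := next w r in ns *.
have [e|r's] := eqVneq r' s; last first.
  rewrite tpermD 1?eq_sym //.
  apply: (Iset_ext (c := ipsum (Iset r' w) r' - ipsum (Iset r' u) r') hw hu) => i.
  have := ipsum_IsetB w r' i; have := ipsum_IsetB u r' i.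
  have [->|ir] := eqVneq i r'; first by lia.
  by rewrite h // (negbTE r'r) (negbTE r's) !andbF /=; lia.
rewrite e tpermR.
apply: (Iset_ext (c := ipsum (Iset s w) s - ipsum (Iset r u) r - shi w s r) hw hu) => i.
have := ipsum_IsetB w s i; have := ipsum_IsetB u r i.
have -> : shi u i r = shi w i r - (i == s)%:Z.
  have [->|ir] := eqVneq i r; first by rewrite !shi_refl eq_sym (negbTE ns).
  by rewrite h // -/s eqxx (negbTE ir) andbT /=; lia.
have [->|is_] := eqVneq i s; first by rewrite shi_refl ns /=; lia.
have [->|ir] := eqVneq i r.
  by rewrite shi_refl (shi_anti w (_ : r != s)) 1?eq_sym //=; lia.
have -> : shi w i r = shi w i s + shi w s r; last by rewrite /=; lia.
have := pos_neq w is_; have := pos_neq w ir; have := ltn_ord (pos w i).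
by rewrite /shi; case: (pos_next_cases w r) => -[-> h']; lia.
Qed.

Section Distance.
Variables (k : nat) (J : 'I_n -> {set 'I_n}) (w0 : {perm 'I_n}).

Lemma Dset_max w : w \in Dset k J -> w ord_max = ord_max.
Proof. by case/DsetP. Qed.

Lemma Dset_desc w : w \in Dset k J -> \sum_l (desc w l)%:Z = k%:Z.
Proof. by case/DsetP. Qed.

Definition pos_part (z : int) : nat := if z is Posz m then m else 0.

(* The number of hyperplanes separating the alcoves of [w] and [w0]; each is
   counted for the one of [(i, j)] and [(j, i)] with positive difference. *)
Definition separation w : nat :=
  (\sum_(p : 'I_n * 'I_n) pos_part (shi w p.1 p.2 - shi w0 p.1 p.2))%N.

Lemma separation0 : separation w0 = 0%N.
Proof. by rewrite /separation big1 // => p _; rewrite subrr. Qed.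

Lemma pos_part_cases (z : int) :
  (pos_part z)%:Z = z /\ 0 <= z \/ pos_part z = 0%N /\ z < 0.
Proof. by case: z => m; [left | right]. Qed.

(** Only the pair of [r] and [next w r] contributes a change: its coordinate moves by one, towards
    that of [w0] exactly when the wall is visible. *)
Lemma separation_neighbour w r u : neighbour w r u ->
  if visible w0 w r then separation w = (separation u).+1
  else separation u = (separation w).+1.
Proof.
move=> h; have ns := next_neq N0 w r; set s := next w r in ns.
have rs : r != s by rewrite eq_sym.
have c : (s, r) != (r, s) by rewrite xpair_eqE (negbTE ns).
have e1 : shi u s r = shi w s r - 1.
  by rewrite h // -/s !eqxx (negbTE ns) /=; lia.
have e2 : shi u r s = shi w r s + 1.
  by rewrite h // -/s !eqxx (negbTE rs) /=; lia.
rewrite /separation.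
rewrite !(bigD1 (r, s) (P := predT)) //= !(bigD1 (s, r) (P := fun p => p != (r, s))) //=.
have -> : (\sum_(p | (p != (r, s)) && (p != (s, r))) pos_part (shi u p.1 p.2 - shi w0 p.1 p.2) =
    \sum_(p | (p != (r, s)) && (p != (s, r))) pos_part (shi w p.1 p.2 - shi w0 p.1 p.2))%N.
  apply: eq_bigr => -[i j] /=; rewrite !xpair_eqE => /andP[h1 h2].
  have [->|ij] := eqVneq i j; first by rewrite !shi_refl.
  by rewrite h // -/s (negbTE h1) (negbTE h2); congr pos_part; lia.
move: (\sum_(_ | _) _)%N => X; rewrite /visible -/s e1 e2.
rewrite (shi_anti w rs) (shi_anti w0 rs).
move: (shi w s r) (shi w0 s r) => K K0.
set z1 := _ - _; set z2 := _ - _; set z3 := _ - _; set z4 := _ - _.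
have := pos_part_cases z1; have := pos_part_cases z2.
have := pos_part_cases z3; have := pos_part_cases z4.
move: (pos_part z1) (pos_part z2) (pos_part z3) (pos_part z4) => p1 p2 p3 p4.
rewrite /z1 /z2 /z3 /z4 => h1 h2 h3 h4.
by case: ifP => hK; lia.
Qed.

Hypothesis w0D : w0 \in Dset k J.

(** Visibility serves twice: by [shi_ordS] the wall is not on the boundary of the hypersimplex, and
    the one coordinate that increases stays at most its value for [w0], which obeys the bound. *)
Lemma exists_neighbour w r : w \in Dset k J -> visible w0 w r ->
  exists2 u, u \in Dset k J & neighbour w r u.
Proof.
move=> wD; rewrite /visible => vis; have ns := next_neq N0 w r.
have [wm wk Jk wb] := (DsetP _ _ _).1 wD; have [w0m w0k _ w0b] := (DsetP _ _ _).1 w0D.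
set s := next w r in vis ns.
have rs : r != s by rewrite eq_sym.
pose K i j := shi w i j + ((i == r) && (j == s))%:Z - ((i == s) && (j == r))%:Z.
(* The lifts of [r] and [s] are consecutive modulo n; shifting each by one exchanges their residues
   and gives an interior point of the reflected alcove. *)
pose a i := lift_pos w i + (i == r)%:Z - (i == s)%:Z.
have aK i j : i != j -> n%:Z * K i j < a i - a j < n%:Z * (K i j + 1).
  move=> ij; have E x y : (x == y) = (pos w x == pos w y :> nat).
    by rewrite (inj_eq val_inj) (inj_eq (@pos_inj _ w)).
  rewrite (_ : a i - a j = lift_pos w i - lift_pos w j
     + ((i == r)%:Z - (i == s)%:Z - (j == r)%:Z + (j == s)%:Z)); last by rewrite /a; ring.
  rewrite lift_posB -addrA /K -!addrA !mulrDr !mulrN; move: (n%:Z * shi w i j) => Z.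
  have pij := pos_neq w ij.
  have li := ltn_ord (pos w i); have lj := ltn_ord (pos w j).
  have P := pos_next_cases w r; rewrite -/s in P.
  rewrite !E {a K E vis wb w0b wk w0k}; move: pij li lj P.
  move: (pos w i : nat) (pos w j : nat) (pos w r : nat) (pos w s : nat) => pi pj pr ps.
  move=> pij li lj P.
  by case: (ltnP pi pj) => c1; case: (eqVneq pi pr) => c2; case: (eqVneq pi ps) => c3;
     case: (eqVneq pj pr) => c4; case: (eqVneq pj ps) => c5 /=; rewrite ?mulr1 ?mulr0; lia.
have [|||u [h1 h2 h3]] := @exists_perm_shi _ a n%:Z k%:Z.
- by [].
- move=> i j ij; apply/negP => /dvdzP[q hq].
  by have := aK i j ij; rewrite hq (mulrC q) !ltr_pM2l //; lia.
- move=> l; have sl := ordS_neq N0 l.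
  have e1 := shi_ordS l wk; have e2 := shi_ordS l w0k.
  have e3 : K (ordS l) l = shi w (ordS l) l.
    rewrite /K.
    have -> : (ordS l == r) && (l == s) = false.
      apply/negP => /andP[/eqP e /eqP e']; move: e1 e2; rewrite e e'.
      by rewrite (shi_anti w rs) (shi_anti w0 rs); lia.
    have -> : (ordS l == s) && (l == r) = false.
      by apply/negP => /andP[/eqP e /eqP e']; move: e1 e2; rewrite e e'; lia.
    by lia.
  have := aK _ _ sl; rewrite e3 e1 mulrDr mulr1 mulrN.
  rewrite (_ : n%:Z * (_ * _) = (l == ord_max)%:Z * (n%:Z * k%:Z)); last by ring.
  by move: (_ * (n%:Z * _)) => Z; lia.
have uK i j : i != j -> shi u i j = K i j.
  move=> ij; have /andP[b1 b2] := h3 i j ij; have /andP[b3 b4] := aK i j ij.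
  have c1 : n%:Z * shi u i j < n%:Z * (K i j + 1) by apply: lt_trans b4.
  have c2 : n%:Z * K i j < n%:Z * (shi u i j + 1) by apply: lt_trans b2.
  by move: c1 c2; rewrite !ltr_pM2l //; lia.
exists u; last by move=> i j ij; rewrite uK.
apply/DsetP; split=> // i j ij; rewrite uK // /K.
have := wb i j ij; have := w0b i j ij.
have [/andP[/eqP-> /eqP->]|] := boolP ((i == r) && (j == s)); last by lia.
by rewrite (shi_anti w rs) (shi_anti w0 rs); lia.
Qed.

(** The interior point of [w0] then satisfies all wall inequalities of [w], hence lies in its alcove
    by [shi_sorted]. *)
Lemma no_visible w : w \in Dset k J -> (forall r, ~~ visible w0 w r) -> w = w0.
Proof.
move=> wD nv; apply: perm_shi_inj; rewrite ?Dset_max //.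
apply: (@has_shi_uniq _ (lift_pos w0) n%:Z) => //; last exact: shi_lift.
apply: shi_sorted => // r; have /andP[h _] := shi_lift w0 (next_neq N0 w r).
by apply: le_lt_trans h; rewrite ler_pM2l //; have := nv r; rewrite /visible -leNgt.
Qed.

End Distance.
End Neighbours.

(** * Faces and dimensions *)

Section ConvexHulls.
Variables (R : realType) (n : nat).
Implicit Types (I : finType) (c : 'I_n -> R) (b : R) (x y : 'rV[R]_n).

Definition linform c x : R := \sum_l c l * x 0 l.

Lemma linform_sum c I (P : pred I) (a : I -> R) (v : I -> 'rV[R]_n) :
  linform c (\sum_(i | P i) a i *: v i) = \sum_(i | P i) a i * linform c (v i).
Proof.
rewrite /linform; transitivity (\sum_l \sum_(i | P i) a i * (c l * v i 0 l)).
  apply: eq_bigr => l _; rewrite summxE mulr_sumr; apply: eq_bigr => i _.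
  by rewrite mxE mulrCA.
by rewrite exchange_big; apply: eq_bigr => i _; rewrite mulr_sumr.
Qed.

Lemma conv_hull_vertex I (A : {set I}) (v : I -> 'rV[R]_n) i :
  i \in A -> conv_hull A v (v i).
Proof.
move=> iA; exists (fun j => (j == i)%:R); split=> [j _||].
- by rewrite ler0n.
- by rewrite (bigD1 i) //= eqxx big1 ?addr0 // => j /andP[_ /negbTE->].
by rewrite (bigD1 i) //= eqxx scale1r big1 ?addr0 // => j /andP[_ /negbTE->]; rewrite scale0r.
Qed.

Lemma conv_hull_sub I I' (A : {set I}) (A' : {set I'}) v v' (f : I -> I') :
    (forall i, i \in A -> f i \in A' /\ v i = v' (f i) :> 'rV[R]_n) ->
  (conv_hull A v `<=` conv_hull A' v')%classic.
Proof.
move=> h x [a [a0 a1 ->]]; exists (fun j => \sum_(i in A | f i == j) a i); split.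
- by move=> j _; apply: sumr_ge0 => i /andP[/a0].
- by rewrite -(partition_big f (mem A')) // => i /h[].
rewrite (partition_big f (mem A')) /=; last by move=> i /h[].
apply: eq_bigr => j _; rewrite scaler_suml; apply: eq_bigr => i /andP[/h[_ ->] /eqP->].
by [].
Qed.

Lemma conv_hull_face I (A : {set I}) (v : I -> 'rV[R]_n) c b :
    (forall i, i \in A -> linform c (v i) <= b) ->
  (forall x, conv_hull A v x -> linform c x <= b) /\
  [set x | conv_hull A v x /\ linform c x = b]%classic =
    conv_hull [set i in A | linform c (v i) == b] v.
Proof.
move=> h; have sumB (a : I -> R) : \sum_(i in A) a i = 1 ->
    b - linform c (\sum_(i in A) a i *: v i) = \sum_(i in A) a i * (b - linform c (v i)).
  move=> a1; rewrite linform_sum -[X in X - _]mul1r -a1 mulr_suml -sumrB.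
  by apply: eq_bigr => i _; rewrite mulrBr.
have term_ge0 (a : I -> R) : (forall i, i \in A -> 0 <= a i) ->
    forall i, i \in A -> 0 <= a i * (b - linform c (v i)).
  by move=> a0 i iA; rewrite mulr_ge0 ?a0 // subr_ge0 h.
split=> [x [a [a0 a1 ->]]|].
  by rewrite -subr_ge0 sumB // sumr_ge0 // => i iA; apply: term_ge0.
apply/seteqP; split=> x.
  move=> [[a [a0 a1 xE]] xb]; exists a.
  have z i : i \in A -> linform c (v i) != b -> a i = 0.
    move=> iA nb; have /eqP := sumB a a1; rewrite -xE xb subrr eq_sym.
    rewrite psumr_eq0 => [/allP/(_ i)|j]; last exact: term_ge0.
    have nb' : b - linform c (v i) != 0 by rewrite subr_eq0 eq_sym.
    by rewrite mem_index_enum iA mulf_eq0 (negbTE nb') orbF => /(_ isT)/eqP.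
  (* Stated over a module to serve both the sum of the coefficients, in [R^o], and the point
     itself. *)
  have e (V : lmodType R) (F : I -> V) :
      (forall i, i \in A -> linform c (v i) != b -> F i = 0) ->
      \sum_(i in A) F i = \sum_(i in [set i in A | linform c (v i) == b]) F i.
    move=> hF; rewrite (bigID (fun i => linform c (v i) == b)) /= [X in _ + X]big1 ?addr0.
      by apply: eq_bigl => i; rewrite inE.
    by move=> i /andP[]; apply: hF.
  split.
  - by move=> i; rewrite inE => /andP[/a0].
  - by rewrite -a1; symmetry; apply: (e R^o a).
  - by rewrite xE; apply: e => i iA nb; rewrite z ?scale0r.
move=> xA; split.
  by move: x xA; apply: (@conv_hull_sub _ _ _ _ _ _ id) => i; rewrite inE => /andP[].
case: xA => a [_ a1 ->]; rewrite linform_sum -[RHS]mul1r -a1 mulr_suml.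
by apply: eq_bigr => i; rewrite inE => /andP[_ /eqP->].
Qed.

Lemma is_face_conv_hull I (A A' : {set I}) (v : I -> 'rV[R]_n) c b :
    (forall i, i \in A -> linform c (v i) <= b) ->
    (forall i, i \in A -> (linform c (v i) == b) = (i \in A')) -> A' \subset A ->
  is_face (conv_hull A v) (conv_hull A' v).
Proof.
move=> h1 h2 sA; have [h3 h4] := conv_hull_face h1; exists c, b; split=> //.
rewrite [RHS]h4; congr conv_hull; apply/setP => i; rewrite inE.
by have [/h2->//|] := boolP (i \in A) => iA; apply: contraNF iA => /(fintype.subsetP sA).
Qed.

Definition dirs I (A : {set I}) (v : I -> 'rV[R]_n) i0 : {vspace 'rV[R]_n} :=
  <<[seq v i - v i0 | i <- enum (A :\ i0)]>>%VS.

Lemma mem_dirs I (A : {set I}) (v : I -> 'rV[R]_n) i0 i :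
  i \in A -> v i - v i0 \in dirs A v i0.
Proof.
move=> iA; have [->|h] := eqVneq i i0; first by rewrite subrr mem0v.
by apply/memv_span/map_f; rewrite mem_enum in_setD1 h.
Qed.

Lemma conv_hull_dirs I (A : {set I}) (v : I -> 'rV[R]_n) i0 x :
  conv_hull A v x -> x - v i0 \in dirs A v i0.
Proof.
move=> [a [_ a1 ->]].
have -> : \sum_(i in A) a i *: v i - v i0 = \sum_(i in A) a i *: (v i - v i0).
  under [RHS]eq_bigr do rewrite scalerBr.
  by rewrite sumrB -scaler_suml a1 scale1r.
by apply: memv_suml => i iA; rewrite memvZ ?mem_dirs.
Qed.

Lemma dirs_min I (A : {set I}) (v : I -> 'rV[R]_n) i0 (U : {vspace 'rV[R]_n}) :
    i0 \in A ->
    (forall x y, conv_hull A v x -> conv_hull A v y -> x - y \in U) ->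
  (dirs A v i0 <= U)%VS.
Proof.
move=> i0A h; apply/span_subvP => x /mapP[i]; rewrite mem_enum in_setD1 => /andP[_ iA] ->.
by apply: h; apply: conv_hull_vertex.
Qed.

Lemma has_dim_conv_hull I (A : {set I}) (v : I -> 'rV[R]_n) i0 :
  i0 \in A -> has_dim (conv_hull A v) (\dim (dirs A v i0)).
Proof.
move=> i0A; split; first by exists (v i0); apply: conv_hull_vertex.
exists (dirs A v i0); split=> // [x y xA yA|U]; last exact: dirs_min.
have -> : x - y = (x - v i0) - (y - v i0) by rewrite opprB addrA subrK.
by rewrite memvB ?conv_hull_dirs.
Qed.

Lemma has_dim_uniq (P : set 'rV[R]_n) d d' : has_dim P d -> has_dim P d' -> d = d'.
Proof.
move=> [_ [W [<- h1 h2]]] [_ [W' [<- h1' h2']]].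
by apply/eqP; rewrite eqn_leq !dimvS ?h2 ?h2'.
Qed.

Lemma dim_dirs_le I (A : {set I}) (v : I -> 'rV[R]_n) i0 :
  i0 \in A -> (\dim (dirs A v i0) < #|A|)%N.
Proof.
move=> i0A; rewrite (leq_ltn_trans (dim_span _)) // size_map -cardE.
by rewrite [X in (_ < X)%N](cardsD1 i0) i0A.
Qed.

Lemma dim_dirs_add I (A : {set I}) (v : I -> 'rV[R]_n) i0 r :
  (\dim (dirs A v i0) <= (\dim (dirs (A :\ r) v i0)).+1)%N.
Proof.
have h : (dirs A v i0 <= dirs (A :\ r) v i0 + <[v r - v i0]>)%VS.
  apply/span_subvP => x /mapP[i]; rewrite mem_enum in_setD1 => /andP[_ iA] ->.
  have [->|ir] := eqVneq i r; first by rewrite (subvP (addvSr _ _)) ?memv_line.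
  by rewrite (subvP (addvSl _ _)) // mem_dirs // in_setD1 ir.
apply: leq_trans (dimvS h) (leq_trans (dimv_add_leqif _ _).1 _).
by rewrite -[X in (_ <= X)%N]addn1 leq_add2l dim_vline; case: eqP.
Qed.

Lemma indicator_vecE (B : {set 'I_n}) l : indicator_vec R B 0 l = (l \in B)%:R.
Proof.
rewrite /indicator_vec summxE; case: (boolP (l \in B)) => lB.
  rewrite (bigD1 l) //= mxE !eqxx big1 ?addr0 // => i /andP[_ /negbTE il].
  by rewrite mxE eq_sym il andbF.
rewrite big1 // => i iB; rewrite mxE (_ : (l == i) = false) ?andbF //.
by apply: contraNF lB => /eqP->.
Qed.

Lemma linform_indicator c B : linform c (indicator_vec R B) = \sum_(l in B) c l.
Proof.
rewrite /linform [RHS]big_mkcond; apply: eq_bigr => l _.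
by rewrite indicator_vecE; case: ifP; rewrite ?mulr1 ?mulr0.
Qed.

Lemma indicator_in_conv_hull I (A : {set I}) (f : I -> {set 'I_n}) B :
    conv_hull A (fun i => indicator_vec R (f i)) (indicator_vec R B) ->
  exists i, f i = B.
Proof.
(* Among 0/1 vectors this form is maximal at [B] alone: each element in which a set differs from [B]
   costs 1. *)
pose c l : R := if l \in B then 1 else -1.
have cB (C : {set 'I_n}) : linform c (indicator_vec R B) - linform c (indicator_vec R C) =
    \sum_l ((l \in B) != (l \in C))%:R.
  rewrite /linform -sumrB; apply: eq_bigr => l _; rewrite !indicator_vecE /c.
  by case: (l \in B); case: (l \in C) => /=; ring.
move=> BA; have [|_ h] := @conv_hull_face _ A (fun i => indicator_vec R (f i)) c (linform c (indicator_vec R B)).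
  by move=> i _; rewrite -subr_ge0 cB sumr_ge0.
have : conv_hull [set i in A | linform c (indicator_vec R (f i)) == linform c (indicator_vec R B)]
  (fun i => indicator_vec R (f i)) (indicator_vec R B) by rewrite -h.
move=> [a [_ a1 _]].
have [E|/set0Pn[i]] := eqVneq [set i in A | linform c (indicator_vec R (f i)) == linform c (indicator_vec R B)] finset.set0.
  by move: a1; rewrite E big_set0 => /eqP; rewrite eq_sym oner_eq0.
rewrite inE => /andP[_]; rewrite eq_sym -subr_eq0 cB psumr_eq0 => [/allP H|//].
exists i; apply/setP => l; have := H l; rewrite mem_index_enum pnatr_eq0 eqb0 negbK.
by move=> /(_ isT)/eqP.
Qed.

End ConvexHulls.

(** * Dimension and facets of the simplices *)

Section WSimplices.
Variables (R : realType) (N : nat).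
Local Notation n := N.+1.
Hypothesis N0 : (0 < N)%N.
Implicit Types (i j l r s : 'I_n) (w u v : {perm 'I_n}).

Local Notation e l := (delta_mx 0 l : 'rV[R]_n).
Local Notation vert w := (fun r => indicator_vec R (Iset r w)).

Lemma sum_zero_mem (U : {vspace 'rV[R]_n}) (x : 'rV[R]_n) :
  (forall l, e (ordS l) - e l \in U) -> \sum_l x 0 l = 0 -> x \in U.
Proof.
move=> h x0; have h0 l : e l - e ord0 \in U.
  have [m ml] : exists m, (l : nat) = m by exists l.
  elim: m l ml => [|m IH] l ml.
    by have -> : l = ord0 by [apply: ord_inj]; rewrite subrr mem0v.
  have lm : (m < n)%N by have := ltn_ord l; lia.
  have -> : l = ordS (Ordinal lm).
    apply: ord_inj; rewrite val_ordS //= -(inj_eq val_inj) /=.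
    by have := ltn_ord l; lia.
  by rewrite -(subrK (e (Ordinal lm)) (e (ordS _))) -addrA memvD // IH.
rewrite (row_sum_delta x) (_ : \sum_j _ = \sum_j x 0 j *: (e j - e ord0)).
  by apply: memv_suml => l _; rewrite memvZ.
under [RHS]eq_bigr do rewrite scalerBr.
by rewrite sumrB -scaler_suml x0 scale0r subr0.
Qed.

Lemma dim_ge_ordS (U : {vspace 'rV[R]_n}) :
  (forall l, e (ordS l) - e l \in U) -> (N <= \dim U)%N.
Proof.
move=> h; have H : ({:'rV[R]_n} <= U + <[e ord0]>)%VS.
  apply/subvP => x _; pose a := \sum_l x 0 l.
  rewrite -(subrK (a *: e ord0) x) memv_add ?memvZ ?memv_line //.
  apply: sum_zero_mem => //; under eq_bigr do rewrite !mxE.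
  rewrite sumrB -mulr_sumr (_ : \sum_l _%:R = 1) ?mulr1 ?subrr //.
  by rewrite (bigD1 ord0) //= big1 ?addr0 // => l /negbTE->.
have := leq_trans (dimvS H) (dimv_add_leqif _ _).1.
rewrite dimvf /dim /= mul1n dim_vline; case: eqP => _ /=; lia.
Qed.

(** From the rotation ending with [r] to the one ending with [s], the letter [s] moves from the
    front to the end: a descent appears at [s] and the one at its cyclic predecessor disappears. *)
Lemma vert_next w r s : s = next w r -> forall l, ordS l = s ->
  vert w s - vert w r = e s - e l.
Proof.
move=> sE l ls; apply/rowP => i; rewrite !mxE !indicator_vecE eqxx /=.
have : (i \in Iset s w)%:Z - (i \in Iset r w)%:Z = (i == s)%:Z - (i == l)%:Z.
  rewrite !Iset_desc -(inj_eq (@ordS_inj n) i l) ls.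
  rewrite -(inj_eq (@pos_inj _ w) i s) -(inj_eq (@pos_inj _ w) (ordS i) s).
  rewrite -!(inj_eq val_inj) /=.
  have := ltn_ord (pos w i); have := ltn_ord (pos w (ordS i)).
  by rewrite sE; case: (pos_next_cases N0 w r) => -[-> h]; lia.
by move/(congr1 (fun z : int => z%:~R : R)); rewrite !rmorphB /= => ->.
Qed.

Lemma vert_dirs w r0 l : e (ordS l) - e l \in dirs [set: 'I_n]%SET (vert w) r0.
Proof.
pose r := w (ord_pred (pos w (ordS l))).
have sE : ordS l = next w r by rewrite /next pos_perm ord_predK posK.
rewrite -(vert_next sE (erefl (ordS l))).
have -> : vert w (ordS l) - vert w r = (vert w (ordS l) - vert w r0) - (vert w r - vert w r0).
  by rewrite opprB addrA subrK.
by rewrite memvB // (mem_dirs (vert w)) ?inE.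
Qed.

Lemma dim_dirs_wsimplex w r0 : \dim (dirs [set: 'I_n]%SET (vert w) r0) = N.
Proof.
apply/eqP; rewrite eqn_leq dim_ge_ordS ?andbT => [|l]; last exact: vert_dirs.
have r0T : r0 \in [set: 'I_n]%SET by rewrite inE.
by have := dim_dirs_le (vert w) r0T; rewrite cardsT card_ord.
Qed.

Lemma has_dim_wsimplex w : has_dim (wsimplex R w) N.
Proof.
have r0T : (ord0 : 'I_n) \in [set: 'I_n]%SET by rewrite inE.
by have := has_dim_conv_hull (vert w) r0T; rewrite dim_dirs_wsimplex.
Qed.

Lemma has_dim_wsimplex_sup (P : set 'rV[R]_n) w (b : R) :
    (wsimplex R w `<=` P)%classic -> (forall x, P x -> \sum_l x 0 l = b) ->
  has_dim P N.
Proof.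
move=> sub Pb; have [[x xw] _] := has_dim_wsimplex w.
split; first by exists x; apply: sub.
exists (dirs [set: 'I_n]%SET (vert w) ord0); split; first exact: dim_dirs_wsimplex.
  move=> y z /Pb yb /Pb zb; apply: sum_zero_mem => [l|]; first exact: vert_dirs.
  by under eq_bigr do rewrite !mxE; rewrite sumrB yb zb subrr.
by move=> U h; apply: dirs_min => [|y z yw zw]; rewrite ?inE //; apply: h; apply: sub.
Qed.

(** By dimension a facet contains all vertices of the simplex of [w] but at most one. They lie in
    the simplex of [u], and a 0/1 vector in a hull of 0/1 vectors is one of them. *)
Lemma share_facet_vertices w u : share_facet (wsimplex R w) (wsimplex R u) ->
  exists r, forall r', r' != r -> exists r'', Iset r' w = Iset r'' u.
Proof.
move=> [F [[[c [b [cb FE]]] [d [dw dF]]] [[c' [b' [_ FE']]] _]]].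
have := has_dim_uniq dw (has_dim_wsimplex w) => dN.
have [|_ h] := @conv_hull_face R n _ [set: 'I_n]%SET (vert w) c b.
  by move=> i iT; apply: cb; apply: conv_hull_vertex.
set A := [set i in _ | _] in h.
have FA : F = conv_hull A (vert w) by rewrite FE -h.
have [i0 i0A] : exists i0, i0 \in A.
  case: dF => [[x]]; rewrite FA => -[a [_ a1 _]] _.
  have [E|/set0Pn//] := eqVneq A finset.set0.
  by move: a1; rewrite E big_set0 => /eqP; rewrite eq_sym oner_eq0.
have dA : d = \dim (dirs A (vert w) i0).
  by apply: has_dim_uniq dF _; rewrite FA; apply: has_dim_conv_hull.
have cA : (N <= #|A|)%N by rewrite -[X in (X <= _)%N]dN dA dim_dirs_le.
have [r hr] : exists r, forall r', r' != r -> r' \in A.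
  have cC : (#|~: A| <= 1)%N by have := cardsC A; rewrite card_ord; lia.
  have [E|/set0Pn[r rC]] := eqVneq (~: A) finset.set0.
    by exists ord0 => r' _; move/setP/(_ r'): E; rewrite !inE => /negbFE.
  exists r => r' r'r; apply: contraNT r'r => r'A; apply/eqP.
  by apply: (card_le1_eqP cC) => //; rewrite inE.
exists r => r' /hr r'A.
have : F (vert w r') by rewrite FA; apply: conv_hull_vertex.
rewrite FE' => -[+ _]; move/indicator_in_conv_hull => [r'' e].
by exists r''.
Qed.

Lemma linform_ipsum (B : {set 'I_n}) i j :
  linform (fun l => (l < i)%:R - (l < j)%:R) (indicator_vec R B) = (ipsum B i - ipsum B j)%:~R.
Proof.
rewrite /ipsum /psum !(big_mkcond (fun l : 'I_n => (l < _)%N)) -sumrB rmorph_sum /linform.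
apply: eq_bigr => l _; rewrite indicator_vecE rmorphB /=.
by case: (l < i)%N; case: (l < j)%N; case: (l \in B) => /=; ring.
Qed.

Lemma is_facet_opposite w r c b :
    (forall r', linform c (vert w r') <= b) ->
    (forall r', (linform c (vert w r') == b) = (r' != r)) ->
  is_facet (wsimplex R w) (conv_hull [set~ r] (vert w)).
Proof.
move=> h1 h2; split.
  by apply: (@is_face_conv_hull R n _ _ _ _ c b) => [i _|i _|]; rewrite ?finset.subsetT // h2 !inE.
exists N.-1; rewrite prednK //; split; first exact: has_dim_wsimplex.
have [i0 i0A] : exists i0, i0 \in [set~ r].
  by exists (next w r); rewrite !inE next_neq.
have -> : N.-1 = \dim (dirs [set~ r] (vert w) i0).
  have := dim_dirs_le (vert w) i0A; have := dim_dirs_add [set: 'I_n]%SET (vert w) i0 r.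
  rewrite dim_dirs_wsimplex finset.setTD cardsC1 card_ord /= => le_dim lt_dim.
  by apply: succn_inj; rewrite prednK //; apply/eqP; rewrite eqn_leq le_dim.
exact: has_dim_conv_hull.
Qed.

(** The wall form equals [shi w s r] on the common vertices, one more at [Iset r w] and one less at
    [Iset s u]: the simplices lie on opposite sides of their common facet. *)
Lemma neighbour_share_facet w r u k :
    \sum_l (desc w l)%:Z = k%:Z -> \sum_l (desc u l)%:Z = k%:Z ->
    neighbour w r u ->
  share_facet (wsimplex R u) (wsimplex R w).
Proof.
move=> hw hu h; have ns := next_neq N0 w r; set s := next w r in ns.
have vE r' : r' != r -> Iset r' w = Iset (tperm r s r') u by apply: (neighbour_Iset N0 hw hu h).
have W r' : ipsum (Iset r' w) s - ipsum (Iset r' w) r = shi w s r + (r' == r)%:Z.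
  by rewrite !ipsum_Iset; have := Iset_next_psum r' N0 (erefl s); lia.
have U r' : ipsum (Iset r' u) s - ipsum (Iset r' u) r = shi w s r - (r' == s)%:Z.
  have [->|r's] := eqVneq r' s.
    rewrite !ipsum_Iset ltnn -[shi w s r](subrK 1) -(_ : shi u s r = shi w s r - 1).
      by rewrite /shi /=; lia.
    by rewrite h // -/s !eqxx (negbTE ns) /=; lia.
  have tr : tperm r s r' != r.
    by rewrite -[X in _ != X](tpermR r s) (inj_eq perm_inj).
  by have := vE _ tr; rewrite tpermK => <-; rewrite W (negbTE tr) /=; lia.
exists (conv_hull [set~ r] (vert w)); split; last first.
  apply: (@is_facet_opposite w r (fun l => (l < r)%N%:R - (l < s)%N%:R) (- (shi w s r))%:~R) => r'; rewrite linform_ipsum.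
    by rewrite ler_int; have := W r'; case: (r' == r) => /=; lia.
  by rewrite eqr_int; have := W r'; case: (r' == r) => /=; lia.
rewrite (_ : conv_hull _ _ = conv_hull [set~ s] (vert u)).
  apply: (@is_facet_opposite u s (fun l => (l < s)%N%:R - (l < r)%N%:R) (shi w s r)%:~R) => r'; rewrite linform_ipsum.
    by rewrite ler_int; have := U r'; case: (r' == s) => /=; lia.
  by rewrite eqr_int; have := U r'; case: (r' == s) => /=; lia.
apply/seteqP; split; apply: (conv_hull_sub (f := tperm r s)) => i; rewrite !inE => hi.
  by rewrite -vE // -[X in _ != X](tpermL r s) (inj_eq perm_inj).
have hr : tperm r s i != r by rewrite -[X in _ != X](tpermR r s) (inj_eq perm_inj).
by rewrite vE // tpermK.
Qed.

End WSimplices.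

(** * Distance and covers *)

(* [f] is forced to be the distance to [w0] in [Gamma_J]: it grows by at most 1
   along an edge, and every vertex other than [w0] has a neighbour where it is
   smaller by 1. *)
Section DistancePoset.
Variables (R : realType) (n k : nat) (J : 'I_n -> {set 'I_n}) (w0 : {perm 'I_n}).
Variable f : {perm 'I_n} -> nat.
Implicit Types (u v w x : {perm 'I_n}) (p q : seq {perm 'I_n}).
Local Notation D := (Dset k J).
Local Notation adj := (@Gamma_adj R n k J).
Hypothesis w0D : w0 \in D.
Hypothesis f0 : f w0 = 0%N.
Hypothesis f_adj : forall u w, adj u w -> (f w <= (f u).+1)%N.
Hypothesis f_pred : forall w, w \in D -> w != w0 -> exists2 u, adj u w & f w = (f u).+1.

Lemma adj_mem u w : adj u w -> u \in D /\ w \in D.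
Proof. by case/and4P. Qed.

Lemma path_length u p : path adj u p -> (f (last u p) <= f u + size p)%N.
Proof.
elim: p u => [|x p IH] u /=; first by rewrite addn0.
by case/andP => /f_adj h /IH; lia.
Qed.

Lemma exists_shortest v : v \in D ->
  exists p, [/\ path adj w0 p, last w0 p = v & size p = f v].
Proof.
have [m fm] : exists m, f v = m by exists (f v).
elim: m v fm => [|m IH] v fm vD.
  have [->|vw] := eqVneq v w0; first by exists [::]; rewrite f0.
  by have [u _] := f_pred vD vw; rewrite fm.
have [e|vw] := eqVneq v w0; first by move: fm; rewrite e f0.
have [u uv fu] := f_pred vD vw; have [uD _] := adj_mem uv.
have [|p [h1 h2 h3]] := IH u _ uD; first by lia.
by exists (rcons p v); rewrite rcons_path last_rcons size_rcons h1 h2 uv h3.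
Qed.

Lemma shortest_pathP v p : v \in D ->
  shortest_path R k J w0 v p <-> [/\ path adj w0 p, last w0 p = v & size p = f v].
Proof.
move=> vD; split=> [[h1 h2 h3]|[h1 h2 h3]]; split=> //.
  have [q [q1 q2 q3]] := exists_shortest vD; have := h3 q q1 q2.
  by have := path_length h1; rewrite f0 h2; lia.
by move=> q q1 q2; have := path_length q1; rewrite f0 q2 h3.
Qed.

Lemma shortest_prefix v p1 p2 : path adj w0 (p1 ++ p2) -> last w0 (p1 ++ p2) = v ->
  size (p1 ++ p2) = f v -> f (last w0 p1) = size p1.
Proof.
rewrite cat_path last_cat size_cat => /andP[h1 h2] h3 h4.
by have := path_length h1; have := path_length h2; rewrite h3 f0; lia.
Qed.

Lemma prec_lt u v : prec R k J w0 u v -> (f u < f v)%N.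
Proof.
move=> [uD vD uv [p /(shortest_pathP _ vD)[h1 h2 h3] up]].
case/splitPl: up h1 h2 h3 => p1 p2 p1u h1 h2 h3.
have := shortest_prefix h1 h2 h3; rewrite p1u -h3 size_cat => ->.
rewrite -{1}[size p1]addn0 ltn_add2l lt0n size_eq0.
by apply: contraNneq uv => p20; rewrite -p1u -h2 p20 cats0.
Qed.

Lemma coversP u w : covers R k J w0 w u <-> adj u w /\ f w = (f u).+1.
Proof.
split=> [[uw H]|[uw fw]].
  have [uD wD neq [p /(shortest_pathP _ wD)[h1 h2 h3] up]] := uw.
  case/splitPl: up h1 h2 h3 => p1 p2 p1u.
  have [p20|] := eqVneq p2 [::].
    by rewrite p20 cats0 p1u => _ e; rewrite e eqxx in neq.
  case/lastP: p2 => // p2 w' _ h1 h2 h3.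
  have w'w : w' = w by rewrite -h2 last_cat last_rcons.
  rewrite -rcons_cat {w'}w'w in h1 h2 h3.
  have fu' : f (last w0 (p1 ++ p2)) = size (p1 ++ p2).
    by rewrite -cats1 in h1 h2 h3; apply: (shortest_prefix h1 h2 h3).
  move: h1; rewrite rcons_path => /andP[h1 u'w].
  set u' := last w0 (p1 ++ p2) in fu' u'w.
  have fw : f w = (f u').+1 by rewrite fu' -h3 size_rcons.
  have [uu'|uu'] := eqVneq u u'; first by rewrite uu'.
  have [u'D _] := adj_mem u'w.
  (* The vertex just before [w] on the path, if it is not [u], lies strictly between [u] and [w]. *)
  case: H; exists u'; split; split=> //.
  - exists (p1 ++ p2); first by apply/shortest_pathP.
    by rewrite -p1u -cat_cons mem_cat mem_last.
  - by case/and4P: u'w.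
  exists (rcons (p1 ++ p2) w).
    by apply/shortest_pathP; rewrite // rcons_path last_rcons h1 u'w.
  by rewrite -rcons_cons mem_rcons inE mem_last orbT.
have [uD wD] := adj_mem uw; split.
  split=> //; first by case/and4P: uw.
  have [p [h1 h2 h3]] := exists_shortest uD.
  exists (rcons p w).
    apply/shortest_pathP => //.
    by rewrite rcons_path last_rcons size_rcons h1 h2 uw h3.
  by rewrite -rcons_cons mem_rcons inE -h2 mem_last orbT.
by move=> [x [/prec_lt h1 /prec_lt h2]]; lia.
Qed.

Lemma cover_numE w : cover_num R k J w0 w = #|[set u | adj u w & f w == (f u).+1]|.
Proof.
rewrite /cover_num; apply: eq_card => u; rewrite !inE; apply/asboolP/andP.
  by move/coversP => [-> ->].
by move=> [h /eqP e]; apply/coversP.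
Qed.

End DistancePoset.

(** * Ehrhart series *)

Section PowerSeries.
Implicit Types (p q : {poly int}) (a : nat -> int).

Lemma fps_mul_polyM p a m : fps_mul (fun i => ((1 - 'X) * p)`_i) a m =
  fps_mul (fun i => p`_i) (fun t => a t - (if t is t'.+1 then a t' else 0)) m.
Proof.
rewrite /fps_mul.
under eq_bigr do rewrite mulrBl mul1r coefB coefXM mulrBl.
under [RHS]eq_bigr do rewrite mulrBr.
rewrite !sumrB; congr (_ - _).
rewrite big_ord_recl /= mul0r add0r [RHS]big_ord_recr /= subnn mulr0 addr0.
by apply: eq_bigr => i _; rewrite /bump /= add1n; case: m i => [[]//|m] i; rewrite subSS subSn // -ltnS.
Qed.

(** The series is z^c / (1 - z)^(d+1). A factor [1 - 'X] takes differences, and Pascal's rule then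
    lowers [d] by one. *)
Lemma fps_mul_binomial d c m :
  fps_mul (fun i => ((1 - 'X) ^+ d.+1)`_i)
    (fun t => if (c <= t)%N then 'C(t - c + d, d)%:Z else 0) m = (m == c)%:Z.
Proof.
have D0 (b : nat) : (fun t => (if (c <= t)%N then b%:Z else 0) -
   (if t is t'.+1 then (if (c <= t')%N then b%:Z else 0) else 0)) =1
   (fun t => if t == c then b%:Z else 0).
  move=> [|t]; first by case: c => [|c] //=; lia.
  case: (ltngtP c t.+1) => h.
  - by rewrite -ltnS h subrr.
  - by rewrite leqNgt (ltnW h) subrr.
  - by rewrite h ltnn subr0.
elim: d m => [|d IH] m.
  rewrite expr1 -[1 - 'X]mulr1 fps_mul_polyM /fps_mul.
  rewrite (bigD1 ord0) //= coef1 mul1r subn0 big1 ?addr0.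
    by have := D0 1%N m; case: m => [|m] /=; rewrite ?bin0 => ->; case: eqP.
  by move=> i; rewrite -(inj_eq val_inj) coef1 => /negbTE /= ->; rewrite mul0r.
rewrite exprS fps_mul_polyM -IH; apply: eq_bigr => i _; congr (_ * _).
case: (m - i)%N => [|t]; first by case: c {D0 IH} => [|c] //=; rewrite ?subn0 ?add0n ?binn.
case: (ltngtP c t.+1) => h.
- rewrite -ltnS h subSn // !addnS !addSn binS PoszD.
  by rewrite addrAC subrr add0r.
- by rewrite leqNgt (ltnW h) /= subr0.
by rewrite h ltnn subnn !add0n !binn subr0.
Qed.

End PowerSeries.

(** These are the lattice points of a dilated unimodular simplex off the facets in [V]. Subtracting
    1 on [V] leaves weak compositions of [t - #|V|]; the range ['I_t.+1] loses nothing, as the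
    entries sum to [t]. *)
Lemma card_compositions N t (V : {set 'I_N.+1}) :
  #|[set m : {ffun 'I_N.+1 -> 'I_t.+1} |
      ((\sum_r m r)%N == t) && [forall r, (r \in V) ==> (0 < m r)%N]]| =
  if (#|V| <= t)%N then 'C(t - #|V| + N, N) else 0%N.
Proof.
set S := [set m | _]; have cV : (\sum_r (r \in V) = #|V|)%N.
  by rewrite -sum1_card [RHS]big_mkcond.
have le_m (m : {ffun 'I_N.+1 -> 'I_t.+1}) r : m \in S -> ((r \in V) <= m r)%N.
  by rewrite inE => /andP[_ /forallP/(_ r)]; case: (r \in V).
case: leqP => [Vt|tV]; last first.
  apply/eqP; rewrite cards_eq0 -finset.subset0; apply/fintype.subsetP => m mS.
  have : (#|V| <= \sum_r m r)%N by rewrite -cV; apply: leq_sum => r _; apply: le_m.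
  by move: mS; rewrite inE => /andP[/eqP-> _]; rewrite leqNgt tV.
set T := [set s : N.+1.-tuple 'I_(t - #|V|).+1 | (\sum_(i <- s) i)%N == (t - #|V|)%N].
have -> : 'C(t - #|V| + N, N) = #|T| by rewrite card_ord_partitions addnC.
pose g (s : N.+1.-tuple 'I_(t - #|V|).+1) : {ffun 'I_N.+1 -> 'I_t.+1} :=
  [ffun r => inord (tnth s r + (r \in V))].
have sumT (s : N.+1.-tuple 'I_(t - #|V|).+1) : (\sum_(i <- s) i = \sum_r tnth s r)%N.
  by rewrite big_tuple.
have gE s r : s \in T -> g s r = (tnth s r + (r \in V))%N :> nat.
  rewrite inE sumT => /eqP sT; rewrite ffunE inordK // ltnS -[X in (_ <= X)%N](subnK Vt) leq_add //.
    by rewrite -ltnS ltn_ord.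
  by rewrite -cV (bigD1 r) //= leq_addr.
have -> : S = g @: T.
  apply/setP => m; apply/idP/imsetP => [mS|[s sT ->]].
    pose s := [tuple inord (m r - (r \in V)) | r < N.+1] : N.+1.-tuple 'I_(t - #|V|).+1.
    have sumE : (\sum_r (m r - (r \in V)) = t - #|V|)%N.
      rewrite sumnB => [|r _]; last exact: le_m.
      by rewrite cV; move: mS; rewrite inE => /andP[/eqP->].
    have sE r : tnth s r = (m r - (r \in V))%N :> nat.
      by rewrite tnth_mktuple inordK // ltnS -sumE (bigD1 r) //= leq_addr.
    have sT : s \in T.
      by rewrite inE sumT; apply/eqP; rewrite -[RHS]sumE; apply: eq_bigr => r _; rewrite sE.
    exists s => //; apply/ffunP => r; apply: ord_inj.
    by rewrite gE // sE subnK // le_m.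
  rewrite inE; apply/andP; split.
    under eq_bigr do rewrite gE //; rewrite big_split /= cV -sumT.
    by move: sT; rewrite inE => /eqP->; rewrite subnK.
  by apply/forallP => r; apply/implyP => rV; rewrite gE // rV addn1.
apply: card_in_imset => s s' sT s'T e; apply: eq_from_tnth => r; apply: ord_inj.
have := congr1 (fun m : {ffun 'I_N.+1 -> 'I_t.+1} => m r : nat) e.
by rewrite !gE // => /addIn.
Qed.

(** * Lattice points of dilates, cell by cell *)

Section Main.
Variables (R : realType) (N k : nat).
Local Notation n := N.+1.
Variables (J : 'I_n -> {set 'I_n}) (w0 : {perm 'I_n}).
Hypothesis N0 : (0 < N)%N.
Hypothesis w0D : w0 \in Dset k J.
Implicit Types (i j l r s : 'I_n) (w u v : {perm 'I_n}) (t : nat).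
Local Notation D := (Dset k J).
Local Notation P := (positroid_polytope R k J).
Local Notation adj := (@Gamma_adj R n k J).

Lemma neighbour_adj w r u : w \in D -> u \in D -> neighbour w r u -> adj u w.
Proof.
move=> wD uD h; apply/and4P; split=> //; first exact: neighbour_neq h.
by apply/asboolP; apply: (neighbour_share_facet R N0 (Dset_desc wD) (Dset_desc uD) h).
Qed.

Lemma adj_neighbour u w : adj u w -> exists r, neighbour w r u.
Proof.
case/and4P => uD wD uw /asboolP[F [Fu Fw]].
have [|r hr] := @share_facet_vertices R N N0 w u; first by exists F.
by exists r; apply: shares_vertices_neighbour hr => //; apply: Dset_max; eassumption.
Qed.

Lemma separation_adj u w : adj u w -> (separation w0 w <= (separation w0 u).+1)%N.
Proof.
case/adj_neighbour => r /(separation_neighbour N0 w0).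
by case: ifP => _ ->; rewrite // ltnW.
Qed.

Lemma separation_pred w : w \in D -> w != w0 ->
  exists2 u, adj u w & separation w0 w = (separation w0 u).+1.
Proof.
move=> wD ww0.
have [/existsP[r vis]|/existsPn nv] := boolP [exists r, visible w0 w r]; last first.
  by case/eqP: ww0; apply: (no_visible N0 w0D).
have [u uD h] := exists_neighbour N0 w0D wD vis.
exists u; first exact: neighbour_adj h.
by have := separation_neighbour N0 w0 h; rewrite vis.
Qed.

(** Covered elements are the neighbours of smaller separation. Each wall has at most one alcove
    across it, and the separation drops exactly when a visible wall is crossed. *)
Lemma cover_num_visible w : w \in D ->
  cover_num R k J w0 w = #|[set r | visible w0 w r]|.
Proof.
move=> wD; rewrite (cover_numE w0D (separation0 w0) separation_adj separation_pred).
pose g r := odflt w [pick u | (u \in D) && `[< neighbour w r u >]].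
have gP r : visible w0 w r -> g r \in D /\ neighbour w r (g r).
  move=> vis; rewrite /g; case: pickP => [u /andP[uD /asboolP h] //|].
  have [u uD h] := exists_neighbour N0 w0D wD vis.
  by move=> /(_ u); rewrite uD /= => /asboolP.
rewrite -(card_in_imset (f := g)); last first.
  move=> r r'; rewrite !inE => /gP[_ h] /gP[_ h'] e.
  by apply: (neighbour_index_inj N0 h); rewrite e.
apply: eq_card => u; rewrite inE; apply/andP/imsetP => [[uw /eqP e]|[r]].
  have [r h] := adj_neighbour uw; have := separation_neighbour N0 w0 h.
  case: ifP => vis; last by rewrite e => /eqP; lia.
  move=> _; exists r; first by rewrite inE.
  have [gD hg] := gP r vis; case/and4P: uw => uD _ _ _.
  by apply: neighbour_inj h hg; apply: Dset_max; eassumption.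
rewrite inE => vis ->; have [gD hg] := gP r vis.
split; first exact: neighbour_adj hg.
by have := separation_neighbour N0 w0 hg; rewrite vis => ->.
Qed.

Lemma wsimplex_sub w : w \in D -> (wsimplex R w `<=` P)%classic.
Proof. by move=> wD; apply: (conv_hull_sub (f := fun r => Iset r w)) => r _; rewrite Iset_bases. Qed.

Lemma sum_polytope y : P y -> \sum_l y 0 l = k%:R.
Proof.
move=> [a [_ a1 ->]]; have := linform_sum (fun=> 1) (mem (positroid_bases k J)) a (indicator_vec R).
rewrite {1}/linform; under eq_bigr do rewrite mul1r; move=> ->.
rewrite -[RHS]mul1r -a1 mulr_suml; apply: eq_bigr => B /basesP[cB _ _].
by rewrite linform_indicator sumr_const cB.
Qed.

Lemma has_dim_polytope : has_dim P N.
Proof. exact: has_dim_wsimplex_sup (wsimplex_sub w0D) sum_polytope. Qed.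

Definition cells t : {set {perm 'I_n} * {ffun 'I_n -> 'I_t.+1}} :=
  [set q : {perm 'I_n} * {ffun 'I_n -> 'I_t.+1} | (q.1 \in D) && (((\sum_r q.2 r)%N == t) &&
           [forall r, (r \in [set r | visible w0 q.1 r]) ==> (0 < q.2 r)%N])].

Definition cell_point t (q : {perm 'I_n} * {ffun 'I_n -> 'I_t.+1}) : 'rV[int]_n :=
  \row_l comb q.1 (fun r => (q.2 r)%:Z) l.

Lemma cell_coord t q r : q \in cells t ->
  coord q.1 t (fun l => cell_point q 0 l) r = (q.2 r)%:Z.
Proof.
rewrite inE => /and3P[_ /eqP qt _].
have : \sum_r (q.2 r)%:Z = t by rewrite -[in RHS]qt -natz natr_sum; apply: eq_bigr => i _; rewrite natz.
move=> /(coord_comb N0 q.1 r) <-; rewrite /coord /psum.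
by congr (_ - _ - _); apply: eq_bigr => l _; rewrite mxE.
Qed.

Lemma cell_has_shi t q : q \in cells t ->
  has_shi (pert w0 (fun l => cell_point q 0 l)) (pert_mod N t) q.1.
Proof.
move=> qt; apply: has_shi_half_open => // r; rewrite cell_coord //; split=> // vis.
by move: qt; rewrite inE => /and3P[_ _ /forallP/(_ r)]; rewrite inE vis.
Qed.

(** The perturbed point lies in a single alcove, which gives the word; [coord] then recovers the
    coefficients. *)
Lemma cell_point_inj t : {in cells t &, injective (@cell_point t)}.
Proof.
move=> q q' qt q't e; have h := cell_has_shi qt; have h' := cell_has_shi q't.
have eq1 : q.1 = q'.1.
  rewrite -e in h'.
  have qm : q.1 ord_max = ord_max by move: qt; rewrite inE => /andP[/Dset_max].
  have qm' : q'.1 ord_max = ord_max by move: q't; rewrite inE => /andP[/Dset_max].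
  by apply: perm_shi_inj => //; apply: has_shi_uniq h h'; apply: pert_mod_gt0.
have eq2 : q.2 = q'.2.
  apply/ffunP => r; apply: ord_inj; apply/eqP; rewrite -eqz_nat.
  by rewrite -!cell_coord // e eq1.
by case: q q' {qt q't e h h'} eq1 eq2 => [? ?] [? ?] /= -> ->.
Qed.

Lemma cell_point_dilate t q : q \in cells t ->
  dilate t P (map_mx intr (cell_point q)).
Proof.
rewrite inE => /and3P[qD /eqP qt _].
have E : map_mx intr (cell_point q) = \sum_r (q.2 r)%:R *: indicator_vec R (Iset r q.1).
  apply/rowP => l; rewrite !mxE summxE /comb rmorph_sum; apply: eq_bigr => r _.
  by rewrite mxE indicator_vecE rmorphM.
(* The coefficients cannot be divided by [t = 0]; there the point is 0, the dilate of any vertex. *)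
have [t0|t0] := posnP t.
  exists (indicator_vec R (Iset ord0 q.1)).
    by apply: (wsimplex_sub qD); apply: (conv_hull_vertex (fun r => indicator_vec R (Iset r q.1))); rewrite inE.
  rewrite E (_ : t%:R = 0) ?scale0r ?[in LHS]t0 // big1 // => r _.
  have : (q.2 r <= t)%N by rewrite -ltnS ltn_ord.
  by rewrite [X in (_ <= X)%N]t0 leqn0 => /eqP->; rewrite scale0r.
have tn0 : t%:R != 0 :> R by rewrite pnatr_eq0 -lt0n.
exists (\sum_r (t%:R^-1 * (q.2 r)%:R) *: indicator_vec R (Iset r q.1)).
  apply: (wsimplex_sub qD); exists (fun r => t%:R^-1 * (q.2 r)%:R); split=> [r _||].
  - by rewrite mulr_ge0 ?invr_ge0.
  - rewrite (eq_bigl predT) => [|r]; last by rewrite inE.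
    by rewrite -mulr_sumr -natr_sum qt mulVf.
  - by apply: eq_bigl => r; rewrite inE.
rewrite E scaler_sumr; apply: eq_bigr => r _.
by rewrite scalerA mulrA divff // mul1r.
Qed.

Lemma dilate_le t (z : 'rV[int]_n) c b : (forall B, B \in positroid_bases k J ->
    linform c (indicator_vec R B) <= b) ->
  dilate t P (map_mx intr z) -> linform c (map_mx intr z) <= t%:R * b.
Proof.
move=> h [y Py <-]; have [/(_ y Py) hy _] := conv_hull_face h.
rewrite (_ : linform c (t%:R *: y) = t%:R * linform c y) ?ler_wpM2l //.
by rewrite /linform mulr_sumr; apply: eq_bigr => l _; rewrite mxE mulrCA.
Qed.

(** The inequalities that [exists_region] asks for are linear, so they pass from the bases to t
    P. *)
Lemma dilate_cell_point t (z : 'rV[int]_n) : dilate t P (map_mx intr z) ->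
  exists2 q, q \in cells t & z = cell_point q.
Proof.
move=> hz; pose x l := z 0 l.
have xk : \sum_l x l = t%:Z * k%:Z.
  apply: (@intr_inj R); case: hz => y /sum_polytope yk yz.
  rewrite rmorph_sum rmorphM /= -!pmulrn -yk mulr_sumr; apply: eq_bigr => l _.
  by have := congr1 (fun y : 'rV[R]_n => y 0 l) yz; rewrite !mxE.
have x01 l : 0 <= x l <= t%:Z.
  have lin (c : R) : linform (fun i => if i == l then c else 0) (map_mx intr z) = c * (x l)%:~R.
    rewrite /linform (bigD1 l) //= eqxx big1 ?addr0 ?mxE // => i /negbTE->.
    by rewrite mul0r.
  have ind (c : R) B : linform (fun i => if i == l then c else 0) (indicator_vec R B) = c * (l \in B)%:R.
    rewrite /linform (bigD1 l) //= eqxx big1 ?addr0 ?indicator_vecE // => i /negbTE->.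
    by rewrite mul0r.
  have h1 := @dilate_le t z (fun i => if i == l then -1 else 0) 0 _ hz.
  have h2 := @dilate_le t z (fun i => if i == l then 1 else 0) 1 _ hz.
  rewrite !lin in h1 h2; rewrite -!(ler_int R).
  apply/andP; split.
    rewrite -oppr_le0 -mulN1r -[X in _ <= X](mulr0 t%:R); apply: h1 => B _.
    by rewrite ind mulN1r oppr_le0.
  rewrite -[X in X <= _]mul1r -[X in _ <= X]mulr1; apply: h2 => B _.
  by rewrite ind mul1r lern1 leq_b1.
have xb i j : i != j -> psum x i - psum x j <= t%:Z * bound J j i.
  move=> ij; rewrite -(ler_int R) rmorphM /=.
  have <- : linform (fun l => (l < i)%N%:R - (l < j)%N%:R) (map_mx intr z) = (psum x i - psum x j)%:~R :> R.
    rewrite /psum !(big_mkcond (fun l : 'I_n => (l < _)%N)) -sumrB rmorph_sum /linform.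
    apply: eq_bigr => l _; rewrite mxE rmorphB /= -/(x l).
    by case: (l < i)%N; case: (l < j)%N => /=; ring.
  apply: dilate_le hz => B /basesP[_ _ hB].
  by rewrite linform_ipsum ler_int hB.
have [w wD hw] := exists_region N0 w0D (isT : 0 <= t%:Z) xk x01 xb.
have ho := half_open_coord N0 hw.
pose c r := `|coord w t x r|%N.
have cE r : (c r)%:Z = coord w t x r by rewrite /c gez0_abs //; case: (ho r).
have csum : (\sum_r c r = t)%N.
  apply/eqP; rewrite -eqz_nat -(sum_coord N0 w t x) -natz natr_sum; apply/eqP.
  by apply: eq_bigr => r _; rewrite natz cE.
pose m : {ffun 'I_n -> 'I_t.+1} := [ffun r => inord (c r)].
have mE r : m r = c r :> nat.
  by rewrite ffunE inordK // ltnS -csum (bigD1 r) //= leq_addr.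
exists (w, m).
  rewrite inE wD /=; apply/andP; split.
    by rewrite -[X in _ == X]csum; apply/eqP/eq_bigr => r _; rewrite mE.
  apply/forallP => r; rewrite inE; apply/implyP => vis; rewrite mE -ltz_nat cE.
  by have [_ /(_ vis)] := ho r; lia.
apply/rowP => l; rewrite mxE -/(x l) -(comb_coord N0 (Dset_desc wD) xk l).
by rewrite /comb; apply: eq_bigr => r _; rewrite mE cE.
Qed.

Lemma ehrhart_polytope t : ehrhart P t =
  (\sum_(w in D) if (cover_num R k J w0 w <= t)%N
     then 'C(t - cover_num R k J w0 w + N, N) else 0)%N.
Proof.
rewrite /ehrhart; set S := (X in fset_set X).
have -> : S = [set` [fset cell_point q | q in cells t]%fset]%classic.
  apply/seteqP; split=> z /=.
    by move=> /dilate_cell_point[q qt ->]; apply/imfsetP; exists q.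
  by case/imfsetP => q /= qt ->; apply: cell_point_dilate.
rewrite set_fsetK card_in_imfset /=; last exact: cell_point_inj.
rewrite -cardE -sum1_card.
under [RHS]eq_bigr => w wD do
  rewrite (cover_num_visible wD) -card_compositions -sum1_card.
rewrite pair_big_dep /=; apply: eq_bigl => -[w m].
by rewrite !inE.
Qed.

Lemma hstar_polytope :
  is_hstar P (\sum_(w in D) 'X^(cover_num R k J w0 w)).
Proof.
exists N; first exact: has_dim_polytope.
move=> m; rewrite coef_sum.
transitivity (\sum_(w in D) fps_mul (fun i : nat => ((1 - 'X) ^+ N.+1)`_i)
    (fun t => if (cover_num R k J w0 w <= t)%N
     then 'C(t - cover_num R k J w0 w + N, N)%:Z else 0) m).
  rewrite /fps_mul exchange_big; apply: eq_bigr => i _.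
  rewrite ehrhart_polytope -mulr_sumr -natz natr_sum; congr (_ * _).
  by apply: eq_bigr => w _; rewrite natz; case: ifP.
by apply: eq_bigr => w _; rewrite fps_mul_binomial coefXn; case: eqP.
Qed.

End Main.

Theorem theorem1p1 (R : realType) (n k : nat) (J : 'I_n -> {set 'I_n})
  (hk : (1 <= k <= n)%N)
  (hJ : grassmann_necklace k J)
  (hconn : matroid_connected (positroid_bases k J))
  (w0 : {perm 'I_n}) (hw0 : w0 \in Dset k J) :
  is_hstar (positroid_polytope R k J)
    (\sum_(w in Dset k J) 'X^(cover_num R k J w0 w)).
Proof.
case/andP: hk => k0 kn.
case: n J kn hJ hconn w0 hw0 => [|N] J kn _ _ w0 hw0; first by lia.
by apply: hstar_polytope => //; apply: Dset_gt0 hw0.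
Qed.
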